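(* Let $p$ be an odd prime. Bousfield's category $\mathcal{A}(p)$ is isomorphic to the category of discrete $A$-modules: every discrete $A$-module, regarded as an $R$-module via the inclusion $R\subset A$, is a Bousfield module, and every Bousfield module admits a unique $A$-module structure extending its $R$-module structure which makes it a discrete $A$-module.
   Context: $\mathbb{Z}_{(p)}$ denotes the $p$-local integers and $\mathbb{Z}_{(p)}^\times$ its group of units. $A=K^0_{(p)}(K_{(p)})$ is the ring of degree zero stable operations in $p$-local complex $K$-theory. Fix $q$ primitive modulo $p^2$, let $\Psi^q\in A$ be the Adams operation, $q_i=q^{(-1)^i\lfloor i/2\rfloor}$, $\Theta_n(X)=\prod_{i=1}^n(X-q_i)$, $\Phi_n=\Theta_n(\Psi^q)$. Every element of $A$ is uniquely a convergent sum $\sum_{n\ge0}a_n\Phi_n$, $a_n\in\mathbb{Z}_{(p)}$. Let $A_m=\{\sum_{n\ge m}a_n\Phi_n\}$. An $A$-module $M$ is discrete if for each $x\in M$ there is $n$ with $A_nx=0$ (equivalently, the action $A\times M\to M$ is continuous for the $A_m$-filtration topology on $A$ and the discrete topology on $M$); the category of discrete $A$-modules is the full subcategory of $A$-modules on these objects. Let $R=\mathbb{Z}_{(p)}[\mathbb{Z}_{(p)}^\times]$ be the group ring, writing $\Psi^j$ for $j\in\mathbb{Z}_{(p)}^\times$; sending $\Psi^j$ to the Adams operation $\Psi^j\in A$ gives an inclusion $R\subset A$. Bousfield's category $\mathcal{A}(p)$ is the full subcategory of $R$-modules $M$ (Bousfield modules) such that for each $x\in M$: (a) $Rx$ is finitely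 generated over $\mathbb{Z}_{(p)}$; (b) for each $j\in\mathbb{Z}_{(p)}^\times$, $\Psi^j$ acts on $Rx\otimes\mathbb{Q}$ by a diagonalisable matrix whose eigenvalues are integer powers of $j$; (c) for each $m\ge1$ the action of $\mathbb{Z}_{(p)}^\times$ on $Rx/p^mRx$ factors through $\mathbb{Z}_{(p)}^\times\to(\mathbb{Z}/p^k\mathbb{Z})^\times$ for sufficiently large $k$. *)

(* Defs.v *)
From HB Require Import structures.
From mathcomp Require Import all_boot all_order all_algebra.
Set Implicit Arguments. Unset Strict Implicit. Unset Printing Implicit Defensive.
Import Order.TTheory GRing.Theory Num.Theory.
Local Open Scope ring_scope.

Definition zpl (p : nat) (x : rat) : bool := ~~ (p %| `|denq x|)%N.
Definition zunit (p : nat) (x : rat) : bool := [&& zpl p x, x != 0 & zpl p x^-1].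

Definition primitive_mod (q : int) (n : nat) : Prop :=
  coprimez q n /\
  forall k : nat, (0 < k < totient n)%N -> ~ (n%:Z %| q ^+ k - 1)%Z.

Definition qexp (i : nat) : int := (-1) ^+ i * (i./2)%:Z.
Definition qq (q : int) (i : nat) : rat := (q%:~R : rat) ^ (qexp i).
Definition Theta (q : int) (n : nat) (x : rat) : rat :=
  \prod_(1 <= i < n.+1) (x - qq q i).

(* An element theta of A is represented by the sequence of its values
   i |-> theta(q_{i+1}) ("Psi^q := q_{i+1}"), i.e. by its images in the
   quotients A/A_m = Z_(p)[X]/Theta_m(X) embedded by evaluation at
   q_1,...,q_m.  Sum of sum_n a_n Phi_n at q_{i+1} is finite since
   Theta_n(q_{i+1}) = 0 for n > i.  Ring operations are pointwise. *)
Definition evalA (q : int) (a : nat -> rat) : nat -> rat :=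
  fun i => \sum_(n < i.+1) a n * Theta q n (qq q i.+1).

Definition inAn (p : nat) (q : int) (m : nat) (f : nat -> rat) : Prop :=
  exists a : nat -> rat,
    (forall n, zpl p (a n)) /\ (forall n, (n < m)%N -> a n = 0) /\ f = evalA q a.
Definition inA p q f := inAn p q 0 f.

Definition constA (c : rat) : nat -> rat := fun _ => c.
Definition psiA (q : int) (j : rat) : nat -> rat :=
  fun i => j ^ (qexp i.+1).

Definition isAmodule (p : nat) (q : int) (M : zmodType)
    (act : (nat -> rat) -> M -> M) : Prop :=
  (forall f g x, inA p q f -> inA p q g -> act (fun i => f i + g i) x = act f x + act g x) /\
  (forall f x y, inA p q f -> act f (x + y) = act f x + act f y) /\
  (forall f g x, inA p q f -> inA p q g -> act (fun i => f i * g i) x = act f (act g x)) /\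
  (forall x, act (fun _ => 1) x = x).

Definition discreteA (p : nat) (q : int) (M : zmodType)
    (act : (nat -> rat) -> M -> M) : Prop :=
  forall x : M, exists n : nat, forall f, inAn p q n f -> act f x = 0.

(* ---------- R-modules, R = Z_(p)[Z_(p)^x] ---------- *)
Definition isRmodule (p : nat) (M : zmodType)
    (sc : rat -> M -> M) (psi : rat -> M -> M) : Prop :=
  (forall c d x, zpl p c -> zpl p d -> sc (c + d) x = sc c x + sc d x) /\
  (forall c x y, zpl p c -> sc c (x + y) = sc c x + sc c y) /\
  (forall c d x, zpl p c -> zpl p d -> sc (c * d) x = sc c (sc d x)) /\
  (forall x, sc 1 x = x) /\
  (forall j x y, zunit p j -> psi j (x + y) = psi j x + psi j y) /\
  (forall j c x, zunit p j -> zpl p c -> psi j (sc c x) = sc c (psi j x)) /\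
  (forall x, psi 1 x = x) /\
  (forall j k x, zunit p j -> zunit p k -> psi (j * k) x = psi j (psi k x)).

Definition inRx (p : nat) (M : zmodType) (sc psi : rat -> M -> M) (x y : M) : Prop :=
  exists s : seq (rat * rat),
    (forall cj, cj \in s -> zpl p cj.1 && zunit p cj.2) /\
    y = \sum_(cj <- s) sc cj.1 (psi cj.2 x).

Definition bousfield (p : nat) (M : zmodType) (sc psi : rat -> M -> M) : Prop :=
  isRmodule p sc psi /\
  forall x : M,
  (exists gs : seq M, (forall g, g \in gs -> inRx p sc psi x g) /\
     forall y, inRx p sc psi x y ->
       exists cs : seq rat, size cs = size gs /\ (forall c, c \in cs -> zpl p c) /\
         y = \sum_(i < size gs) sc (nth 0 cs i) (nth 0 gs i)) /\
  (* (b) Psi^j on R x (x) Q is diagonalisable with eigenvalues integer powers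
     of j: it is annihilated by a product of distinct factors (X - j^k) *)
  (forall j, zunit p j -> exists ks : seq int,
     forall y, inRx p sc psi x y -> exists n : nat, (0 < n)%N /\
       (foldr (fun l z => psi j z - sc l z) y (undup [seq j ^ k | k <- ks])) *+ n = 0) /\
  (* (c) the action on R x / p^m R x factors through (Z/p^k)^x for k large *)
  (forall m : nat, (0 < m)%N -> exists k : nat,
     forall j j', zunit p j -> zunit p j' -> zpl p ((j - j') / (p ^ k)%:R) ->
       forall y, inRx p sc psi x y ->
         exists z, inRx p sc psi x z /\ psi j y - psi j' y = sc (p ^ m)%:R z).

(* Main.v *)
Require Import Defs.
From HB Require Import structures.
From mathcomp Require Import all_boot all_order all_algebra cyclic.
From mathcomp Require Import zify ring.
From Stdlib Require Import ClassicalEpsilon FunctionalExtensionality.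
Set Implicit Arguments. Unset Strict Implicit. Unset Printing Implicit Defensive.
Import Order.TTheory GRing.Theory Num.Theory.
Local Open Scope ring_scope.

(* Write nd 0, nd 1, ... for the nodes 1, q, q^-1, q^2, ... An element of A is a
   function on the nodes that agrees, on any finite number of them, with a
   polynomial over Z_(p), and it lies in A_n iff it vanishes at the first n nodes.
   So A acts on an element x killed by A_n through Z_(p)[X]/Theta_n, with X acting
   as Psi^q; this gives the Bousfield axioms for discrete modules and the uniqueness.
   The powers of q are p-adically dense in the units, and interpolation at n nodes
   has bounded denominators; hence, modulo Theta_n and p^m, Psi^j is (Psi^q)^s as
   soon as q^s is close to j.

   Conversely, in a Bousfield module Theta_n(Psi^q) x is torsion for large n by (b),
   and by (c) it is then fixed by some (Psi^q)^N with N = (p-1) p^k. Over F_p the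
   product of X - q^e over N consecutive exponents e is X^N - 1, so each such block
   of factors of Theta_n' / Theta_n gains a power of p, and Theta_n'(Psi^q) x = 0 for
   some n'. Then f in A acts on x as F(Psi^q), where F interpolates f at the first
   n' nodes. That Psi^j in A acts as psi j follows from (c) and the density of the
   powers of q modulo each p^m, hence exactly by Krull's theorem for R x. *)

(** * Polynomials over a subring: division by products of linear factors *)

Section PolyOver.
Variables (R : idomainType) (S : subringClosed R).
Implicit Types (F G H : {poly R}) (a c : R) (s : seq R).

Lemma polyOver_ind (P : {poly R} -> Prop) : P 0 ->
  (forall F c, F \is a polyOver S -> c \in S -> P F -> P (F * 'X + c%:P)) ->
  forall F, F \is a polyOver S -> P F.
Proof.
move=> P0 PS F; elim/poly_ind: F => [//|F c IHF] FS.
have FcS i : (F * 'X + c%:P)`_i \in S by move/polyOverP: FS.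
have cS : c \in S by move: (FcS 0%N); rewrite coefD coefMX coefC add0r.
have {}FS : F \is a polyOver S.
  apply/polyOverP => i; move: (FcS i.+1).
  by rewrite coefD coefMX coefC addr0.
exact: PS (IHF FS).
Qed.

Lemma polyOver_divXsubC F a : F \is a polyOver S -> a \in S ->
  exists2 G, G \is a polyOver S & F = G * ('X - a%:P) + F.[a]%:P.
Proof.
move=> FS aS; move: F FS; apply: polyOver_ind => [|F c FS cS [G GS eG]].
  by exists 0; rewrite ?rpred0 // mul0r horner0 addr0.
exists (G * 'X + F.[a]%:P).
  by rewrite rpredD ?rpredM ?polyOverX // polyOverC rpred_horner.
rewrite {1}eG hornerMXaddC polyCD polyCM; ring.
Qed.

Lemma polyOver_prodXsubC s : {subset s <= S} ->
  \prod_(a <- s) ('X - a%:P) \is a polyOver S.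
Proof.
move=> sS; rewrite big_seq; apply: rpred_prod => a /sS aS.
by rewrite polyOverXsubC.
Qed.

(** Dividing by one monic linear factor at a time involves no inverses, so quotient and remainder
    stay over [S]. *)
Lemma polyOver_division s F : {subset s <= S} -> F \is a polyOver S ->
  exists G H, [/\ G \is a polyOver S, H \is a polyOver S, (size H <= size s)%N
    & F = G * \prod_(a <- s) ('X - a%:P) + H].
Proof.
elim: s F => [|a s IHs] F sS FS.
  by exists F, 0; split; rewrite ?rpred0 ?size_poly0 // big_nil mulr1 addr0.
have aS : a \in S by apply: sS; rewrite mem_head.
have [F1 F1S eF] := polyOver_divXsubC FS aS.
have [|G [H [GS HS sH eF1]]] := IHs F1 _ F1S.
  by move=> b bs; apply: sS; rewrite inE bs orbT.
exists G, (H * ('X - a%:P) + F.[a]%:P); split=> //.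
- by rewrite rpredD ?rpredM ?polyOverXsubC // polyOverC rpred_horner.
- rewrite (leq_trans (size_polyD _ _)) // geq_max (leq_trans (size_polyC_leq1 _)) //.
  by rewrite andbT (leq_trans (size_polyMleq _ _)) // size_XsubC addn2.
- by rewrite {1}eF eF1 big_cons; ring.
Qed.

(** The remainder has size at most that of [s] and vanishes at the distinct elements of [s], hence
    is zero. *)
Lemma polyOver_roots s F : uniq s -> {subset s <= S} -> F \is a polyOver S ->
  {in s, forall a, F.[a] = 0} ->
  exists2 G, G \is a polyOver S & F = G * \prod_(a <- s) ('X - a%:P).
Proof.
move=> Us sS FS F0; have [G [H [GS HS sH eF]]] := polyOver_division sS FS.
exists G => //; rewrite eF (_ : H = 0) ?addr0 //.
apply: (roots_geq_poly_eq0 _ Us) => //; apply/allP => a sa.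
have := F0 a sa; rewrite eF hornerD hornerM horner_prod.
rewrite (big_rem a sa) /=.
by rewrite hornerXsubC subrr mul0r mulr0 add0r => /eqP.
Qed.

End PolyOver.


(** * The p-local integers *)

Section PLocal.
Variable p : nat.
Hypothesis p_pr : prime p.
Local Notation "'pi'" := (p%:R : rat).

Lemma zpl_frac (a b : int) : ~~ (p %| `|b|)%N -> zpl p (a%:~R / b%:~R).
Proof.
rewrite /zpl; case: divqP => [n|k x _]; first by rewrite dvdn0.
by apply: contra => pd; rewrite abszM dvdn_mull.
Qed.

Lemma zplE (x : rat) : zpl p x ->
  exists a b : int, ~~ (p %| `|b|)%N /\ x = a%:~R / b%:~R.
Proof. by move=> xZ; exists (numq x), (denq x); rewrite divq_num_den. Qed.

Lemma nondvd_neq0 (b : int) : ~~ (p %| `|b|)%N -> (b%:~R : rat) != 0.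
Proof. by rewrite intr_eq0; apply: contra => /eqP ->; rewrite dvdn0. Qed.

Lemma zpl_subring_closed : subring_closed (zpl p).
Proof.
split=> [|_ _ /zplE[a [b [pb ->]]] /zplE[c [d [pd ->]]]
         |_ _ /zplE[a [b [pb ->]]] /zplE[c [d [pd ->]]]].
- by rewrite unfold_in /zpl dvdn1; case: p p_pr => [|[]].
- have -> : (a%:~R / b%:~R - c%:~R / d%:~R : rat)
      = (a * d - c * b)%:~R / (b * d)%:~R.
    have := nondvd_neq0 pb; have := nondvd_neq0 pd.
    by rewrite rmorphB !rmorphM /= => d0 b0; field; rewrite b0 d0.
  by apply: zpl_frac; rewrite abszM Euclid_dvdM // negb_or pb.
- have -> : (a%:~R / b%:~R * (c%:~R / d%:~R) : rat)
      = (a * c)%:~R / (b * d)%:~R.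
    have := nondvd_neq0 pb; have := nondvd_neq0 pd.
    by rewrite !rmorphM /= => d0 b0; field; rewrite b0 d0.
  by apply: zpl_frac; rewrite abszM Euclid_dvdM // negb_or pb.
Qed.

HB.instance Definition _ :=
  GRing.isSubringClosed.Build rat (zpl p) zpl_subring_closed.

Lemma zpl0 : zpl p 0. Proof. exact: (rpred0 _ : 0 \in zpl p). Qed.
Lemma zpl1 : zpl p 1. Proof. exact: (rpred1 _ : 1 \in zpl p). Qed.
Lemma zplD x y : zpl p x -> zpl p y -> zpl p (x + y).
Proof. exact: (@rpredD _ _ x y : x \in zpl p -> y \in zpl p -> _ \in zpl p). Qed.
Lemma zplN x : zpl p x -> zpl p (- x).
Proof. exact: (@rpredNr _ _ x : x \in zpl p -> _ \in zpl p). Qed.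
Lemma zplB x y : zpl p x -> zpl p y -> zpl p (x - y).
Proof. exact: (@rpredB _ _ x y : x \in zpl p -> y \in zpl p -> _ \in zpl p). Qed.
Lemma zplM x y : zpl p x -> zpl p y -> zpl p (x * y).
Proof. exact: (@rpredM _ _ x y : x \in zpl p -> y \in zpl p -> _ \in zpl p). Qed.
Lemma zplX x n : zpl p x -> zpl p (x ^+ n).
Proof. exact: (@rpredX _ _ n x : x \in zpl p -> _ \in zpl p). Qed.
Lemma zpl_sum (I : Type) (r : seq I) (P : pred I) (F : I -> rat) :
  (forall i, P i -> zpl p (F i)) -> zpl p (\sum_(i <- r | P i) F i).
Proof. exact: (@rpred_sum _ _ _ r P F : _ -> _ \in zpl p). Qed.
Lemma zpl_int (z : int) : zpl p z%:~R.
Proof. exact: (rpred_int _ z : _ \in zpl p). Qed.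
Lemma zpl_nat (n : nat) : zpl p n%:R.
Proof. exact: (rpred_nat _ n : _ \in zpl p). Qed.

Lemma zpl_horner F a : F \is a polyOver (zpl p) -> zpl p a -> zpl p F.[a].
Proof. move=> FZ aZ; exact: (rpred_horner FZ (aZ : a \in zpl p)). Qed.

Lemma pi_neq0 : pi != 0.
Proof. by rewrite pnatr_eq0 -lt0n prime_gt0. Qed.

Lemma piX_neq0 n : pi ^+ n != 0.
Proof. by rewrite expf_neq0 // pi_neq0. Qed.

Lemma zunit_zpl x : zunit p x -> zpl p x. Proof. by case/and3P. Qed.
Lemma zunit_neq0 x : zunit p x -> x != 0. Proof. by case/and3P. Qed.
Lemma zunitV x : zunit p x -> zunit p x^-1.
Proof. by case/and3P=> xZ x0 xVZ; rewrite /zunit invrK invr_eq0 x0 xVZ. Qed.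
Lemma zunitM x y : zunit p x -> zunit p y -> zunit p (x * y).
Proof.
case/and3P=> xZ x0 xVZ /and3P[yZ y0 yVZ].
by rewrite /zunit mulf_neq0 // invfM !zplM.
Qed.
Lemma zunit1 : zunit p 1.
Proof. by rewrite /zunit invr1 zpl1 oner_neq0. Qed.
Lemma zunitX x n : zunit p x -> zunit p (x ^+ n).
Proof.
by move=> xU; elim: n => [|n IHn]; rewrite ?zunit1 // exprS zunitM.
Qed.
Lemma zunit_exprz x (n : int) : zunit p x -> zunit p (x ^ n).
Proof.
by move=> xU; case: n => n; rewrite ?NegzE -?exprnN ?zunitV // zunitX.
Qed.

Lemma zpl_le m n x : (m <= n)%N -> zpl p (x / pi ^+ n) -> zpl p (x / pi ^+ m).
Proof.
move=> le_mn xZ; have -> : x / pi ^+ m = x / pi ^+ n * pi ^+ (n - m).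
  have := piX_neq0 m; have := piX_neq0 (n - m) => a0 b0.
  by rewrite -[in RHS](subnK le_mn) addnK exprD; field; rewrite a0 b0.
by rewrite zplM // zplX // zpl_nat.
Qed.

Lemma zpl_divX n x : zpl p (x / pi ^+ n) -> zpl p x.
Proof. by move/(zpl_le (leq0n n)); rewrite expr0 divr1. Qed.

(** Lets p-adic estimates in [rat] be read as divisibility in Z: the denominator of the quotient is
    prime to p, and Gauss's lemma removes it. *)
Lemma zpl_div_int n (z : int) : zpl p (z%:~R / pi ^+ n) = (p%:Z ^+ n %| z)%Z.
Proof.
apply/idP/idP => [|/dvdzP[k ->]]; last first.
  by rewrite rmorphM rmorphXn /= mulfK ?zpl_int // -pmulrn piX_neq0.
case/zplE=> a [b [pb /eqP]].
rewrite eqr_div ?piX_neq0 ?nondvd_neq0 // => /eqP e.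
have {}e : z * b = a * p%:Z ^+ n.
  by apply: (@intr_inj rat); rewrite !rmorphM rmorphXn /= e -pmulrn.
rewrite -(@Gauss_dvdzl _ z b); first by rewrite e dvdz_mull.
rewrite /coprimez eqz_nat abszX absz_nat -/(coprime _ _).
by rewrite coprimeXl // prime_coprime.
Qed.

(** The residue field is F_p: modulo p, [a / b] is [a * u] with [u] a Bezout inverse of [b]. *)
Lemma zpl_mod x : zpl p x -> exists t : nat, zpl p ((x - t%:R) / pi).
Proof.
case/zplE=> a [b [pb ->]].
have b0 := nondvd_neq0 pb.
have /coprimezP[[u v] /= uv1] : coprimez b p.
  by rewrite /coprimez eqz_nat absz_nat -/(coprime _ _) coprime_sym prime_coprime.
exists `|((a * u) %% p)%Z|%N.
have p0 : p%:Z != 0 by rewrite eqz_nat -lt0n prime_gt0.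
have -> : (`|((a * u) %% p)%Z|%N%:R : rat) = (a * u - (a * u %/ p)%Z * p)%:~R.
  by rewrite pmulrn gez0_abs ?modz_ge0 //; congr (_%:~R).
have -> : (a%:~R / b%:~R - (a * u - (a * u %/ p)%Z * p)%:~R) / pi
  = (a * v)%:~R / b%:~R + (a * u %/ p)%Z%:~R.
  have: (u%:~R * b%:~R + v%:~R * pi : rat) = 1.
    by rewrite pmulrn -!rmorphM -rmorphD /= uv1.
  have := pi_neq0; rewrite !(rmorphB, rmorphM) /= -!pmulrn => p0' e.
  have -> : a%:~R / b%:~R - (a%:~R * u%:~R - (a * u %/ p)%Z%:~R * pi)
     = a%:~R / b%:~R * (u%:~R * b%:~R + v%:~R * pi) -
        (a%:~R * u%:~R - (a * u %/ p)%Z%:~R * pi) :> rat by rewrite e mulr1.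
  by field; rewrite b0 p0'.
by rewrite zplD ?zpl_int // zpl_frac.
Qed.

Lemma zpl_unit_or_div x : zpl p x -> zunit p x \/ zpl p (x / pi).
Proof.
move=> xZ; have [x0|x0] := eqVneq x 0; first by right; rewrite x0 mul0r zpl0.
case: (zplE xZ) => a [b [pb ex]].
have [pa|pa] := boolP (p %| `|a|)%N.
  right; have /dvdzP[k ea] : (p %| a)%Z by rewrite dvdzE absz_nat.
  rewrite ex ea (_ : _ / pi = k%:~R / b%:~R) ?zpl_frac //.
  have := nondvd_neq0 pb; have := pi_neq0.
  by rewrite rmorphM /= -pmulrn => p0 b0; field; rewrite b0 p0.
left; rewrite /zunit xZ x0 ex invf_div; exact: zpl_frac.
Qed.

Lemma zunitN_div x : zunit p x -> ~~ zpl p (x / pi).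
Proof.
case/and3P=> xZ x0 xVZ; apply/negP => /zplM /(_ xVZ).
rewrite mulrAC divff // mul1r -[pi^-1]mul1r -[1]/(1%:~R) -[pi]expr1 zpl_div_int.
by rewrite expr1 dvdzE absz_nat dvdn1; case: p p_pr => [|[]].
Qed.

Lemma pexpansion c : c != 0 -> exists n : nat, ~~ zpl p (c / pi ^+ n).
Proof.
(* Since n < p ^ n, this power of p exceeds the numerator of [c] in absolute value and cannot divide
   it. *)
move=> c0; exists `|numq c|.+1; apply/negP => cZ.
have : zpl p ((numq c)%:~R / pi ^+ `|numq c|.+1).
  rewrite numqE mulrAC; apply: zplM cZ _; exact: zpl_int.
rewrite zpl_div_int dvdzE abszX absz_nat => /dvdn_leq.
rewrite absz_gt0 numq_eq0 => /(_ c0).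
by apply/negP; rewrite -ltnNge ltnW // ltn_expl // prime_gt1.
Qed.

Lemma zpl_div_all c : (forall n, zpl p (c / pi ^+ n)) -> c = 0.
Proof.
move=> cZ; apply/eqP; apply/negPn/negP => /pexpansion[n].
by rewrite cZ.
Qed.

(** Induction on an [m] for which [c / pi ^+ m] is not p-local: either [c] is a unit, or dividing it
    by p lowers [m]. *)
Lemma zpl_uniformizer c : zpl p c -> c != 0 ->
  exists (n : nat) (u : rat), zunit p u /\ c = pi ^+ n * u.
Proof.
move=> cZ c0; have [m] := pexpansion c0.
elim: m c cZ c0 => [|m IHm] c cZ c0; first by rewrite expr0 divr1 cZ.
have [cU|cpZ] := zpl_unit_or_div cZ; first by exists 0, c; rewrite expr0 mul1r.
rewrite exprS invfM mulrA => /(IHm _ cpZ).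
rewrite mulf_neq0 // ?invr_eq0 ?pi_neq0 // => /(_ isT)[n [u [uU e]]].
exists n.+1, u; split=> //.
by rewrite exprS -mulrA -e mulrC divfK // pi_neq0.
Qed.

Lemma zpl_denominator c : exists N : nat, zpl p (pi ^+ N * c).
Proof.
have [->|c0] := eqVneq c 0; first by exists 0; rewrite mulr0 zpl0.
have d0 : (denq c)%:~R != 0 :> rat by rewrite intr_eq0 denq_neq0.
have [n [u [uU e]]] := zpl_uniformizer (zpl_int (denq c)) d0.
exists n; rewrite -[c]divq_num_den e.
have -> : pi ^+ n * ((numq c)%:~R / (pi ^+ n * u)) = (numq c)%:~R * u^-1.
  by have := piX_neq0 n; have := zunit_neq0 uU => u0 pn0; field; rewrite u0.
by rewrite zplM ?zpl_int //; case/and3P: uU.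
Qed.

Lemma zpl_exprB N a b n : zpl p a -> zpl p b ->
  zpl p ((a - b) / pi ^+ N) -> zpl p ((a ^+ n - b ^+ n) / pi ^+ N).
Proof.
move=> aZ bZ abZ; rewrite subrXX mulrAC; apply: zplM => //.
by apply: zpl_sum => i _; rewrite zplM // zplX.
Qed.

Lemma zpl_exprzB N a b (e : int) : zunit p a -> zunit p b ->
  zpl p ((a - b) / pi ^+ N) -> zpl p ((a ^ e - b ^ e) / pi ^+ N).
Proof.
move=> aU bU abZ.
have posP n : zpl p ((a ^+ n - b ^+ n) / pi ^+ N).
  by rewrite zpl_exprB // zunit_zpl.
case: e => n; first exact: posP.
have anU := zunitX n.+1 aU; have bnU := zunitX n.+1 bU.
rewrite NegzE -!exprnN.
have := zunit_neq0 anU; have := zunit_neq0 bnU => b0 a0.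
have -> : ((a ^+ n.+1)^-1 - (b ^+ n.+1)^-1) / pi ^+ N
   = - ((a ^+ n.+1 - b ^+ n.+1) / pi ^+ N * ((a ^+ n.+1)^-1 * (b ^+ n.+1)^-1)).
  by have := piX_neq0 N => p0; field; rewrite ?a0 ?b0 ?p0.
apply: zplN.
by rewrite zplM // zplM; case/and3P: anU; case/and3P: bnU.
Qed.


Local Notation Zp_poly := (polyOver (zpl p)).

(** Over F_p, a monic polynomial with as many distinct roots as its degree is the product of its
    linear factors. One root [a] is split off at a time: [F.[a]] is divisible by p and [b - a] is a
    unit, so every other [b] remains a root of the quotient modulo p. *)
Lemma zpl_split_mod s (F : {poly rat}) :
  {subset s <= zpl p} -> pairwise (fun a b => zunit p (b - a)) s ->
  F \is a Zp_poly -> F \is monic -> size F = (size s).+1 ->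
  {in s, forall a, zpl p (F.[a] / pi)} ->
  exists2 G, G \is a Zp_poly & \prod_(a <- s) ('X - a%:P) = F + pi *: G.
Proof.
elim: s F => [|a s IHs] F sZ /= => [_ FZ Fmon sF _|/andP[aU Us] FZ Fmon sF F0].
  exists 0; rewrite ?rpred0 // big_nil scaler0 addr0.
  have Fc : F = (F`_0)%:P by apply: size1_polyC; rewrite sF.
  by move/monicP: Fmon; rewrite lead_coefE sF /= => F01; rewrite Fc F01.
have aZ : zpl p a by apply: sZ; rewrite mem_head.
have [G GZ eF] := polyOver_divXsubC FZ aZ.
have G0 : G != 0.
  apply/eqP => G0; move: sF; rewrite eF G0 mul0r add0r => sF.
  by have := size_polyC_leq1 F.[a]; rewrite sF.
have sGX : size (G * ('X - a%:P)) = (size G).+1.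
  by rewrite size_Mmonic ?monicXsubC // size_XsubC addn2.
have lt_sc : (size F.[a]%:P < size (G * ('X - a%:P))%R)%N.
  by rewrite sGX ltnS (leq_trans (size_polyC_leq1 _)) // size_poly_gt0.
have sG : size G = (size s).+1.
  by apply: succn_inj; rewrite -sGX -sF [in RHS]eF size_polyDl.
have Gmon : G \is monic.
  rewrite -(monicMr _ (monicXsubC a)) monicE -(monicP Fmon) [in X in _ == X]eF.
  by rewrite lead_coefDl.
have [||H HZ eH] := IHs G _ Us GZ Gmon sG.
- by move=> b bs; apply: sZ; rewrite inE bs orbT.
- move=> b bs; have bU := allP aU b bs.
  have bas : b \in a :: s by rewrite inE bs orbT.
  have := zplB (F0 b bas) (F0 a (mem_head _ _)).
  rewrite [F.[b]](congr1 (horner^~ b) eF) hornerD hornerM hornerXsubC hornerC.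
  have -> : (G.[b] * (b - a) + F.[a]) / pi - F.[a] / pi
     = G.[b] / pi * (b - a) by have := pi_neq0 => p0; field.
  case/and3P: bU => _ ba0 baV /zplM/(_ baV).
  by rewrite mulfK.
exists (H * ('X - a%:P) - (F.[a] / pi)%:P).
  rewrite rpredB ?rpredM ?polyOverXsubC // polyOverC.
  exact: (F0 a (mem_head _ _)).
set Fa := F.[a] in eF *; rewrite big_cons eH mulrDr eF scalerBr -!mul_polyC -polyCM.
by rewrite [pi * (_ / _)]mulrC divfK ?pi_neq0 //; ring.
Qed.

(** * Powers of q modulo powers of p *)

(** Frobenius modulo p: the inner binomial coefficients are divisible by p, and [H] collects the
    quotients. *)
Lemma zpl_freshman (F G : {poly rat}) : F \is a Zp_poly -> G \is a Zp_poly ->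
  exists2 H, H \is a Zp_poly & (F + G) ^+ p = F ^+ p + G ^+ p + pi *: H.
Proof.
move=> FZ GZ.
exists (\sum_(1 <= i < p) F ^+ (p - i) * G ^+ i *+ ('C(p, i) %/ p)).
  apply: rpred_sum => i _; apply: rpredMn; apply: rpredM; exact: rpredX.
rewrite exprDn -(big_mkord predT (fun i => F ^+ (p - i) * G ^+ i *+ 'C(p, i))).
have p1 : (0 < p)%N by apply: prime_gt0.
rewrite big_nat_recr //= big_ltn // subn0 subnn bin0 binn !expr0 mulr1 mul1r.
rewrite !mulr1n scaler_sumr -addrA [X in _ + X]addrC addrA; congr (_ + _).
apply: eq_big_nat => i /andP[i0 ip].
rewrite scaler_nat -mulrnA divnK // prime_dvd_bin // i0 //.
Qed.

Hypothesis p_odd : odd p.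

(** Iterated Frobenius; since p is odd, the constant term stays -1. *)
Lemma zpl_freshmanXn e k :
  exists2 H, H \is a Zp_poly &
    ('X^e - 1) ^+ (p ^ k) = 'X^(e * p ^ k) - 1 + pi *: H :> {poly rat}.
Proof.
elim: k => [|k [H HZ eH]].
  by exists 0; rewrite ?rpred0 // expn0 muln1 expr1 scaler0 addr0.
have XZ : 'X^(e * p ^ k) - 1 \is a Zp_poly by rewrite rpredB ?rpred1 ?polyOverXn.
have pZ : pi \in zpl p by apply: zpl_nat.
have [|H1 H1Z eH1] := @zpl_freshman _ (pi *: H) XZ; first by rewrite polyOverZ.
have [||H2 H2Z eH2] := @zpl_freshman 'X^(e * p ^ k) (-1).
- by rewrite polyOverXn.
- by rewrite rpredN rpred1.
exists (H2 + pi ^+ p.-1 *: H ^+ p + H1).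
  by rewrite !rpredD // polyOverZ ?rpredX.
rewrite expnSr exprM eH eH1 eH2 exprZn -exprM -mulnA -signr_odd p_odd expr1.
have -> : pi ^+ p = pi * pi ^+ p.-1 by rewrite -exprS prednK ?prime_gt0.
rewrite -scalerA !scalerDr.
by rewrite !addrA.
Qed.

(** The quadratic term is kept apart because in [q_lift] it gains an extra factor p from
    ['C(p, 2)]. *)
Lemma expr1D_mod3 (R : comNzRingType) (x : R) n :
  exists w, (1 + x) ^+ n = 1 + x *+ n + x ^+ 2 *+ 'C(n, 2) + x ^+ 3 * w.
Proof.
elim: n => [|n [w IHn]]; first by exists 0; rewrite !mulr0n mulr0 !addr0.
exists ('C(n, 2)%:R + w + x * w).
rewrite exprS IHn binS bin1 mulrnDr mulrSr.
rewrite -[x *+ n]mulr_natr -[x ^+ 2 *+ n]mulr_natr -[_ *+ 'C(n, 2)]mulr_natr.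
ring.
Qed.

Variable q : int.
Hypothesis q_prim : primitive_mod q (p ^ 2).

Lemma q_nondvd : ~~ (p %| `|q|)%N.
Proof.
case: q_prim => /coprimezP[[u v] /= e] _.
apply/negP => /(@dvdz_mull p u q : is_true (p %| q)%Z -> _) pq.
have : (p %| u * q + v * (p ^ 2)%N)%Z.
  by apply: rpredD; [|rewrite dvdz_mull // expnS PoszM dvdz_mulr].
by rewrite e dvdzE dvdn1 absz_nat; case: p p_pr => [|[]].
Qed.

Lemma totient_sqr : totient (p ^ 2) = (p * p.-1)%N.
Proof. by rewrite totient_pfactor // mulnC expn1. Qed.

(** Fermat's little theorem for a natural number [t] congruent to [j], carried over to [j]. *)
Lemma zunit_fermat j : zunit p j -> zpl p ((j ^+ p.-1 - 1) / pi).
Proof.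
move=> jU; have [t jt] := zpl_mod (zunit_zpl jU).
have jZ := zunit_zpl jU.
have pt : coprime t p.
  rewrite coprime_sym prime_coprime //; apply/negP => /dvdnP[k et].
  have := zunitN_div jU; rewrite -[j](subrK t%:R) mulrDl zplD // et natrM.
  by rewrite mulfK ?pi_neq0 // zpl_nat.
have := Euler_exp_totient pt; rewrite totient_prime // => /eqP.
(* Subtraction in [nat] needs [t ^ p.-1] positive; [t] is not 0, as 0 is coprime to p only if p is
   1. *)
rewrite eqn_mod_dvd; last by rewrite expn_gt0; case: t pt {jt} => // /eqP;
  rewrite gcd0n => p1; move: p_pr; rewrite p1.
move=> /dvdnP[k ek].
have {}ek : (t%:R ^+ p.-1 - 1 : rat) = k%:R * pi.
  rewrite -natrM -ek natrB ?natrX // expn_gt0.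
  by case: (t) ek pt => // _ /eqP; rewrite gcd0n => p1; move: p_pr; rewrite p1.
have -> : (j ^+ p.-1 - 1) / pi =
   (j ^+ p.-1 - t%:R ^+ p.-1) / pi ^+ 1 + (t%:R ^+ p.-1 - 1) / pi.
  by rewrite expr1; ring.
by rewrite ek mulfK ?pi_neq0 // zplD ?zpl_nat // zpl_exprB ?zpl_nat.
Qed.

Local Notation qr := (q%:~R : rat).

Lemma qr_zunit : zunit p qr.
Proof.
have [//|] := zpl_unit_or_div (zpl_int q).
rewrite -[pi]expr1 zpl_div_int expr1 dvdzE absz_nat.
by rewrite (negbTE q_nondvd).
Qed.

Lemma q_fermat : (p %| q ^+ p.-1 - 1)%Z.
Proof.
have := zunit_fermat qr_zunit.
have -> : qr ^+ p.-1 - 1 = (q ^+ p.-1 - 1)%:~R by rewrite rmorphB rmorphXn.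
by rewrite -[pi]expr1 zpl_div_int expr1.
Qed.

Lemma predp_gt1 : (1 < p.-1)%N.
Proof. by case: p p_pr p_odd => [|[|[|[]]]]. Qed.

(** If q^d were 1 modulo p, then q^(pd) would be 1 modulo p^2, although pd is below the totient p(p
    - 1). *)
Lemma q_order_modp d : (0 < d < p.-1)%N -> ~~ (p %| q ^+ d - 1)%Z.
Proof.
case/andP=> d0 dp; apply/negP => /dvdzP[k ek].
have [w ew] := expr1D_mod3 (k * p) p.
case: q_prim => _ /(_ (p * d)%N); rewrite totient_sqr.
rewrite muln_gt0 prime_gt0 // d0 ltn_pmul2l ?prime_gt0 // dp => /(_ isT); apply.
rewrite mulnC exprM -[q ^+ d](subrK 1) ek [_ + 1]addrC ew.
apply/dvdzP; exists (k + k ^+ 2 *+ 'C(p, 2) + k ^+ 3 * p * w).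
by rewrite -mulnn PoszM -[_ *+ p]mulr_natr -[_ *+ 'C(p, 2)]mulr_natr
  -[_ *+ 'C(p, 2)]mulr_natr natz; ring.
Qed.

(** Lifting the exponent. For k = 0, a [u] divisible by p would make q^(p-1) equal to 1 modulo p^2,
    against primitivity. Taking a p-th power then changes [u] only by a multiple of p. *)
Lemma q_lift k : exists u : int, q ^+ (p.-1 * p ^ k) = 1 + p%:Z ^+ k.+1 * u
  /\ ~~ (p %| `|u|)%N.
Proof.
elim: k => [|k [u [eq pu]]].
  rewrite expn0 muln1; have /dvdzP[u eu] := q_fermat.
  exists u; split; first by rewrite -[LHS](subrK 1) eu addrC mulrC.
  apply/negP => pu; case: q_prim => _ /(_ p.-1); rewrite totient_sqr.
  rewrite (ltn_trans _ predp_gt1) // ltn_Pmull ?prime_gt1 //; last first.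
    by rewrite (ltn_trans _ predp_gt1).
  move=> /(_ isT); apply; rewrite eu -mulnn PoszM; apply: dvdz_mul => //.
have [w ew] := expr1D_mod3 (p%:Z ^+ k.+1 * u) p.
have /dvdnP[c ec] : (p %| 'C(p, 2))%N.
  by rewrite prime_dvd_bin //; case: (p) p_pr p_odd => [|[|[]]].
exists (u + p%:Z * (p%:Z ^+ k * u ^+ 2 * c + p%:Z ^+ (k + k) * u ^+ 3 * w)); split.
  rewrite expnSr mulnA exprM eq ew ec !exprS exprD.
  by rewrite -[_ *+ p]mulr_natr -[_ *+ (c * p)]mulr_natr natrM
    !natz; ring.
apply: contra pu => pu.
have : (p %| u + p%:Z * (p%:Z ^+ k * u ^+ 2 * c + p%:Z ^+ (k + k) * u ^+ 3 * w))%Z.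
  by rewrite dvdzE absz_nat.
move=> /rpredB/(_ (dvdz_mulr (p%:Z ^+ k * u ^+ 2 * c + p%:Z ^+ (k + k) * u ^+ 3 * w)
  (dvdzz p))).
by rewrite addrK [_ \in _]dvdzE absz_nat.
Qed.

Lemma zunit_qrB a b : (a < b < a + p.-1)%N -> zunit p (qr ^+ b - qr ^+ a).
Proof.
case/andP=> ab ba.
have -> : qr ^+ b - qr ^+ a = qr ^+ a * (qr ^+ (b - a) - 1).
  by rewrite mulrBr mulr1 -exprD subnKC // ltnW.
apply: zunitM; first exact: zunitX qr_zunit.
have -> : qr ^+ (b - a) - 1 = (q ^+ (b - a) - 1)%:~R by rewrite rmorphB rmorphXn.
have [//|] := zpl_unit_or_div (zpl_int (q ^+ (b - a) - 1)).
rewrite -[pi]expr1 zpl_div_int expr1 (negbTE (q_order_modp _)) //.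
by rewrite subn_gt0 ab ltn_subLR // ltnW.
Qed.

(** By Fermat, these p - 1 consecutive powers of q are roots of X^(p-1) - 1 modulo p; they are
    pairwise incongruent because q has order p - 1 modulo p. *)
Lemma prod_qr_split a : exists2 G, G \is a Zp_poly &
  \prod_(e <- iota a p.-1) ('X - (qr ^+ e)%:P) = 'X^(p.-1) - 1 + pi *: G.
Proof.
have p1 := ltn_trans (ltnSn 0) predp_gt1.
rewrite -(big_map (fun e => qr ^+ e) predT (fun c => 'X - c%:P)).
apply: zpl_split_mod; rewrite ?size_map ?size_iota.
- by move=> _ /mapP[e _ ->]; apply/zplX/zpl_int.
- rewrite pairwise_map.
  move: (leqnn p.-1); move: {1 3}(p.-1) => d.
  elim: d a => [//|d IHd] a ltd /=.
  rewrite IHd ?andbT; last exact: ltnW.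
  apply/allP => b; rewrite mem_iota /= => /andP[ab bd].
  by apply: zunit_qrB; rewrite ab (leq_trans bd) // addSnnS leq_add2l.
- by rewrite -polyC1 polyOverXnsubC; apply: zpl1.
- by rewrite -polyC1 monicXnsubC.
- by rewrite -polyC1 size_XnsubC.
- move=> _ /mapP[e _ ->]; rewrite hornerD hornerN hornerXn hornerC -/qr.
  by apply: zunit_fermat; apply: zunitX qr_zunit.
Qed.

(** Density of the powers of q in the units of Z_(p), one p-adic digit at a time. *)
Lemma zunit_approx N j : zunit p j -> exists s : nat, zpl p ((j - qr ^+ s) / pi ^+ N).
Proof.
move=> jU; have jZ := zunit_zpl jU.
(* Over a full period of exponents the product of the [j - qr ^+ e] is j^(p-1) - 1 modulo p, hence
   divisible by p; so one of the factors is. *)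
have base : exists s : nat, zpl p ((j - qr ^+ s) / pi ^+ 1).
  have [G GZ eG] := prod_qr_split 0.
  have prodU : ~~ zunit p (\prod_(e <- iota 0 p.-1) (j - qr ^+ e)).
    apply/negP => /zunitN_div/negP; apply.
    have := congr1 (horner^~ j) eG; rewrite horner_prod.
    under eq_bigr do rewrite hornerXsubC.
    move=> ->; rewrite !hornerE mulrDl zplD ?zunit_fermat //.
    by rewrite mulrAC divff ?pi_neq0 // mul1r zpl_horner.
  case: (boolP (has (fun e => zpl p ((j - qr ^+ e) / pi ^+ 1)) (iota 0 p.-1))).
    by case/hasP => e _; exists e.
  move/hasPn => nU; case/negP: prodU.
  elim: (iota _ _) nU => [|e r IHr] nU; first by rewrite big_nil zunit1.
  rewrite big_cons zunitM //; last by apply: IHr => x xr; rewrite nU // inE xr orbT.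
  have eZ : zpl p (j - qr ^+ e) by rewrite zplB // zplX ?zpl_int.
  have [//|jp] := zpl_unit_or_div eZ.
  by have := nU e (mem_head _ _); rewrite expr1 jp.
elim: N => [|[|N] [s IHs]] //.
  by exists 0; rewrite expr0 divr1 zplB ?zpl1.
have [u [equ pu]] := q_lift N.
have uU : zunit p u%:~R.
  have [//|] := zpl_unit_or_div (zpl_int u).
  by rewrite -[pi]expr1 zpl_div_int expr1 dvdzE absz_nat (negbTE pu).
have qsU := zunitX s qr_zunit.
set v := (j - qr ^+ s) / pi ^+ N.+1 in IHs.
(* Raising the exponent by [p.-1 * p ^ N * t] multiplies [qr ^+ s] by 1 + t p^(N+1) u modulo
   p^(N+2); [t] is the digit that cancels the remaining error [v]. *)
have [|t tZ] := @zpl_mod (v / (qr ^+ s * u%:~R)).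
  by rewrite zplM //; case/and3P: (zunitM qsU uU).
have [w ew] := expr1D_mod3 (p%:Z ^+ N.+1 * u) t.
exists (s + p.-1 * p ^ N * t)%N.
have {}ew : qr ^+ (p.-1 * p ^ N * t) =
   1 + t%:R * pi ^+ N.+1 * u%:~R + pi ^+ N.+2 *
     (pi ^+ N * (u ^+ 2 * 'C(t, 2)%:Z + p%:Z ^+ N.+1 * u ^+ 3 * w)%:~R).
  rewrite exprM -rmorphXn /= equ -rmorphXn /= ew.
  rewrite -[_ *+ t]mulr_natr -[_ *+ 'C(t, 2)]mulr_natr !natz.
  rewrite !(rmorphD, rmorphM, rmorphXn) /= -!pmulrn !exprS; ring.
set w' := ((_ + _)%:~R) in ew.
have -> : (j - qr ^+ (s + p.-1 * p ^ N * t)) / pi ^+ N.+2 =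
  qr ^+ s * u%:~R * ((v / (qr ^+ s * u%:~R) - t%:R) / pi)
    - qr ^+ s * (pi ^+ N * w').
  rewrite exprD ew /v !exprS.
  have := zunit_neq0 qsU; have := zunit_neq0 uU; have := pi_neq0.
  have := piX_neq0 N => p1 p2 p3 p4; field.
  by rewrite p1 p2 p3 p4.
have qsZ := zunit_zpl qsU.
apply: zplB; first by apply: zplM => //; apply: zplM (zpl_int u).
by apply: zplM => //; apply: zplM (zpl_int _); apply/zplX/zpl_nat.
Qed.

(** * Elements of A as functions on the nodes *)

Local Notation nd := (fun i => qq q i.+1).

Definition nodes n : seq rat := [seq nd i | i <- iota 0 n].
Definition theta_poly n : {poly rat} := \prod_(a <- nodes n) ('X - a%:P).

(** The shift matters, since [qexp 0] and [qexp 1] are both 0. *)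
Lemma qexp_inj : injective (fun i => qexp i.+1).
Proof.
move=> i j; rewrite /qexp -signr_odd -[in RHS]signr_odd.
by case oi: (odd i.+1); case oj: (odd j.+1) => /=;
  rewrite ?expr1 ?expr0 ?mulN1r ?mul1r => e; lia.
Qed.

Lemma qr_exprz_inj : injective (exprz qr).
Proof.
move=> e e' ee.
have qq1 : qr * qr != 1.
  apply/eqP => q21; case: q_prim => _ /(_ 2); apply.
    have := predp_gt1; rewrite totient_sqr; nia.
  suff -> : q ^+ 2 = 1 by rewrite subrr dvdz0.
  by apply: (@intr_inj rat); rewrite expr2 rmorphM.
(* Squaring makes the base positive, as [ieexprIz] requires; q^2 is not 1 by primitivity, 2 being
   less than the totient of p^2. *)
apply: (@ieexprIz _ (qr * qr)) => //; last by rewrite !expfzMl ee.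
by rewrite -expr2 exprn_even_gt0 //= zunit_neq0 // qr_zunit.
Qed.

Lemma nd_inj : injective nd.
Proof. by move=> i j /qr_exprz_inj/qexp_inj. Qed.

Lemma nd_zunit i : zunit p (nd i).
Proof. exact: zunit_exprz qr_zunit. Qed.

Lemma nodes_uniq n : uniq (nodes n).
Proof. by rewrite map_inj_uniq ?iota_uniq //; apply: nd_inj. Qed.

Lemma nodes_zpl n : {subset nodes n <= zpl p}.
Proof. by move=> _ /mapP[i _ ->]; apply: zunit_zpl; apply: nd_zunit. Qed.

Lemma mem_nodes n i : (i < n)%N -> nd i \in nodes n.
Proof. by move=> ltin; apply: map_f; rewrite mem_iota. Qed.

Lemma size_nodes n : size (nodes n) = n.
Proof. by rewrite size_map size_iota. Qed.

Lemma theta_poly_zpl n : theta_poly n \is a Zp_poly.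
Proof. exact: polyOver_prodXsubC (@nodes_zpl n). Qed.

Lemma ThetaE n x : Theta q n x = (theta_poly n).[x].
Proof.
rewrite /Theta big_add1 /= horner_prod big_map /index_iota subn0.
by apply: eq_bigr => i _; rewrite hornerXsubC.
Qed.

Lemma theta_poly_node n i : (i < n)%N -> (theta_poly n).[nd i] = 0.
Proof.
move=> ltin; rewrite horner_prod (big_rem _ (mem_nodes ltin)) /=.
by rewrite hornerXsubC subrr mul0r.
Qed.

Lemma theta_poly_node_neq0 n i : (n <= i)%N -> (theta_poly n).[nd i] != 0.
Proof.
move=> leni; rewrite horner_prod prodf_seq_neq0; apply/allP => _ /mapP[j jn ->].
rewrite hornerXsubC subr_eq0; apply/implyP => _.
apply: contraTneq jn => /nd_inj <-.
by rewrite mem_iota -leqNgt.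
Qed.

Lemma theta_poly_dvd n F : F \is a Zp_poly -> (forall i, (i < n)%N -> F.[nd i] = 0) ->
  exists2 G, G \is a Zp_poly & F = G * theta_poly n.
Proof.
move=> FZ F0; apply: (polyOver_roots (nodes_uniq n) (@nodes_zpl n) FZ).
by move=> _ /mapP[i + ->]; rewrite mem_iota => /andP[_ ?]; apply: F0.
Qed.

Definition eval_nodes (F : {poly rat}) : nat -> rat := fun i => F.[nd i].

(** Membership in the inverse limit of the Z_(p)[X]/Theta_m, without the coefficients of an
    expansion; in this form closure under pointwise operations is immediate. *)
Definition locally_poly (f : nat -> rat) : Prop :=
  forall m, exists2 F, F \is a Zp_poly & forall i, (i < m)%N -> f i = eval_nodes F i.

(** A boolean conjunction, so that [xchoose] can pick the interpolant. *)
Lemma locally_poly_small f : locally_poly f -> forall m, exists F,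
  [&& F \is a Zp_poly, (size F <= m)%N & [forall i : 'I_m, f i == eval_nodes F i]].
Proof.
move=> fP m; have [F FZ fF] := fP m.
have [G [H [GZ HZ sH eF]]] := polyOver_division (@nodes_zpl m) FZ.
exists H; rewrite HZ -{1}(size_nodes m) sH /=.
apply/forallP => i; rewrite fF // /eval_nodes eF hornerD hornerM.
by rewrite -/(theta_poly m) theta_poly_node // mulr0 add0r.
Qed.

(** Newton interpolation. With [F m] the interpolant of size at most m at the first m nodes,
    [F m.+1 - F m] is a scalar multiple of [theta_poly m]; the scalar, which is the coefficient of
    degree m of [F m.+1], is the m-th coefficient of the expansion. *)
Lemma inAn_locally_poly n f :
  inAn p q n f <-> locally_poly f /\ forall i, (i < n)%N -> f i = 0.
Proof.
split=> [[a [aZ [a0 ->]]]|[fP f0]].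
  split=> [m|i ltin]; last first.
    by apply: big1 => k _; rewrite a0 ?mul0r // (leq_trans (ltn_ord k)).
  exists (\sum_(k < m) a k *: theta_poly k).
    by apply: rpred_sum => k _; rewrite polyOverZ ?theta_poly_zpl //; apply: aZ.
  move=> i ltim; rewrite /eval_nodes horner_sum /evalA.
  rewrite (big_ord_widen m (fun k => a k * Theta q k (nd i)) ltim) big_mkcond /=.
  apply: eq_bigr => k _; rewrite hornerZ ThetaE ltnS.
  by case: leqP => // ltik; rewrite theta_poly_node ?mulr0.
pose F m := xchoose (locally_poly_small fP m).
have FZ m : F m \is a Zp_poly by case/and3P: (xchooseP (locally_poly_small fP m)).
have sF m : (size (F m) <= m)%N by case/and3P: (xchooseP (locally_poly_small fP m)).
have Ff m i : (i < m)%N -> (F m).[nd i] = f i.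
  case/and3P: (xchooseP (locally_poly_small fP m)) => _ _ /forallP fF ltim.
  by rewrite (eqP (fF (Ordinal ltim))).
have F_unique m (G : {poly rat}) : (size G <= m)%N ->
    (forall i, (i < m)%N -> G.[nd i] = f i) -> G = F m.
  move=> sG Gf; apply/eqP; rewrite -subr_eq0; apply/eqP.
  apply: (roots_geq_poly_eq0 _ (nodes_uniq m)); last first.
    by rewrite size_nodes (leq_trans (size_polyD _ _)) // geq_max sG size_polyN sF.
  apply/allP => _ /mapP[i + ->]; rewrite mem_iota => /andP[_ ltim].
  by rewrite rootE !hornerE Gf // Ff // subrr.
exists (fun n => (F n.+1)`_n); split=> [m|]; first exact: (polyOverP (FZ _)).
have FS m : F m.+1 = F m + (F m.+1)`_m *: theta_poly m.
  apply/eqP; rewrite -subr_eq; apply/eqP; apply: F_unique => [|i ltim].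
    have smon : size (theta_poly m) = m.+1 by rewrite size_prod_XsubC size_nodes.
    apply/leq_sizeP => k; rewrite leq_eqVlt => /predU1P[<-|ltmk].
      rewrite coefB coefZ -[X in (theta_poly m)`_X]/(m.+1.-1) -smon -lead_coefE.
      by rewrite (monicP (monic_prod_XsubC _ _ _)) mulr1 subrr.
    have thk : (theta_poly m)`_k = 0 by rewrite nth_default // smon.
    have Fk : (F m.+1)`_k = 0 := nth_default 0 (leq_trans (sF _) ltmk).
    by rewrite coefB coefZ thk Fk mulr0 subrr.
  rewrite hornerD hornerN hornerZ theta_poly_node // mulr0 subr0.
  exact: Ff (ltnW _).
have FE m : F m = \sum_(k < m) (F k.+1)`_k *: theta_poly k.
  elim: m => [|m IHm]; last by rewrite FS big_ord_recr /= -IHm.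
  by rewrite big_ord0; apply/eqP; rewrite -size_poly_leq0 sF.
split=> [m ltmn|].
  suff <- : 0 = F m.+1 by rewrite coef0.
  apply: F_unique; rewrite ?size_poly0 // => i leim.
  by rewrite horner0 f0 // (leq_trans leim).
apply: functional_extensionality => i; rewrite /evalA -(Ff i.+1) // FE horner_sum.
by apply: eq_bigr => k _; rewrite hornerZ ThetaE.
Qed.

Lemma inA_locally_poly f : inA p q f <-> locally_poly f.
Proof. by rewrite /inA inAn_locally_poly; split=> [[]|] //; split. Qed.

Lemma inAnW n f : inAn p q n f -> inA p q f.
Proof. by rewrite inA_locally_poly => /inAn_locally_poly[]. Qed.

(** A new node is met by adding a multiple of [theta_poly n], divided by its value [c] there. This
    [c] is nonzero but may be divisible by p, so the exponent grows by a [K] that clears [c^-1]. *)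
Lemma interpolation n : exists N, forall g : nat -> rat,
  (forall i, (i < n)%N -> zpl p (g i / pi ^+ N)) ->
  exists2 F, F \is a Zp_poly & forall i, (i < n)%N -> g i = F.[nd i].
Proof.
elim: n => [|n [N IHn]]; first by exists 0 => g _; exists 0; rewrite ?rpred0.
set c := (theta_poly n).[nd n].
have c0 : c != 0 by apply: theta_poly_node_neq0.
have [K cK] := zpl_denominator c^-1.
exists (N + K)%N => g gZ.
pose g' i := g i / pi ^+ K.
have g'Z i : (i < n.+1)%N -> zpl p (g' i / pi ^+ N).
  by move/gZ; rewrite addnC exprD invfM mulrA.
have [|F FZ gF] := IHn g'; first by move=> i ltin; apply/g'Z/ltnW.
have FnZ : zpl p F.[nd n] by apply: zpl_horner => //; apply/zunit_zpl/nd_zunit.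
exists (pi ^+ K *: F + ((g' n - F.[nd n]) * (pi ^+ K * c^-1)) *: theta_poly n).
  have cZ : zpl p ((g' n - F.[nd n]) * (pi ^+ K * c^-1)).
    by rewrite zplM // zplB // (zpl_divX (g'Z n _)).
  by rewrite rpredD ?polyOverZ ?theta_poly_zpl //; apply/zplX/zpl_nat.
have gE i : g i = pi ^+ K * g' i by rewrite mulrC divfK ?piX_neq0.
move=> i; rewrite ltnS leq_eqVlt => /predU1P[->|ltin].
  by rewrite gE hornerD !hornerZ -/c; field; rewrite c0.
by rewrite gE hornerD !hornerZ theta_poly_node // mulr0 addr0 gF.
Qed.

Lemma eval_nodes_inA F : F \is a Zp_poly -> inA p q (eval_nodes F).
Proof. by move=> FZ; apply/inA_locally_poly => m; exists F. Qed.

(* [N] absorbs the denominators of the Lagrange interpolation at [n] nodes. *)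
Lemma psiA_approx n : exists N, forall m j s,
  zunit p j -> zpl p ((j - qr ^+ s) / pi ^+ (N + m)) ->
  exists2 F, F \is a Zp_poly &
    forall i, (i < n)%N -> psiA q j i = eval_nodes ('X^s + pi ^+ m *: F) i.
Proof.
have [N intN] := interpolation n; exists N => m j s jU jZ.
(* At a node of exponent e, Psi^j and X^s take the values j^e and (q^s)^e, which are congruent to
   the same precision as j and q^s. *)
have [i ltin|F FZ eF] := intN (fun i => (psiA q j i - (nd i) ^+ s) / pi ^+ m).
  rewrite -mulrA -invfM -exprD addnC /psiA /qq.
  have -> : (qr ^ qexp i.+1) ^+ s = (qr ^+ s) ^ qexp i.+1.
    by rewrite exprnP exprzAC.
  by apply: zpl_exprzB => //; apply: zunitX qr_zunit.
exists F => // i ltin; rewrite /eval_nodes hornerD hornerXn hornerZ -eF //.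
by rewrite mulrC divfK ?piX_neq0 // addrC subrK.
Qed.

(** The case m = 0 of [psiA_approx]: only the integrality of the interpolant matters. *)
Lemma psiA_inA j : zunit p j -> inA p q (psiA q j).
Proof.
move=> jU; apply/inA_locally_poly => n; have [N appN] := psiA_approx n.
have [s js] := zunit_approx (N + 0) jU.
have [F FZ jF] := appN 0 j s jU js.
exists ('X^s + pi ^+ 0 *: F) => //.
by rewrite rpredD ?polyOverXn // expr0 scale1r.
Qed.

(** * Modules over the group ring *)

Section RModules.
Variables (M : zmodType) (sc psi : rat -> M -> M).
Hypothesis RM : isRmodule p sc psi.
Implicit Types (F G : {poly rat}) (x y z : M).

Lemma scDl c d x : zpl p c -> zpl p d -> sc (c + d) x = sc c x + sc d x.
Proof. by case: RM => H _; apply: H. Qed.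
Lemma scDr c x y : zpl p c -> sc c (x + y) = sc c x + sc c y.
Proof. by case: RM => _ [H _]; apply: H. Qed.
Lemma scM c d x : zpl p c -> zpl p d -> sc (c * d) x = sc c (sc d x).
Proof. by case: RM => _ [_ [H _]]; apply: H. Qed.
Lemma sc1 x : sc 1 x = x.
Proof. by case: RM => _ [_ [_ [H _]]]; apply: H. Qed.
Lemma psiD j x y : zunit p j -> psi j (x + y) = psi j x + psi j y.
Proof. by case: RM => _ [_ [_ [_ [H _]]]]; apply: H. Qed.
Lemma psi_sc j c x : zunit p j -> zpl p c -> psi j (sc c x) = sc c (psi j x).
Proof. by case: RM => _ [_ [_ [_ [_ [H _]]]]]; apply: H. Qed.
Lemma psi1 x : psi 1 x = x.
Proof. by case: RM => _ [_ [_ [_ [_ [_ [H _]]]]]]; apply: H. Qed.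
Lemma psiM j k x : zunit p j -> zunit p k -> psi (j * k) x = psi j (psi k x).
Proof. by case: RM => _ [_ [_ [_ [_ [_ [_ H]]]]]]; apply: H. Qed.

Lemma sc0l x : sc 0 x = 0.
Proof. by apply: (addrI (sc 0 x)); rewrite -scDl ?zpl0 // !addr0. Qed.
Lemma sc0r c : zpl p c -> sc c 0 = 0.
Proof. by move=> cZ; apply: (addrI (sc c 0)); rewrite -scDr // !addr0. Qed.
Lemma scNl c x : zpl p c -> sc (- c) x = - sc c x.
Proof.
by move=> cZ; apply: (addrI (sc c x)); rewrite -scDl ?zplN // !subrr sc0l.
Qed.
Lemma scN c x : zpl p c -> sc c (- x) = - sc c x.
Proof. by move=> cZ; apply: (addrI (sc c x)); rewrite -scDr // !subrr sc0r. Qed.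
Lemma psi0 j : zunit p j -> psi j 0 = 0.
Proof. by move=> jU; apply: (addrI (psi j 0)); rewrite -psiD // !addr0. Qed.
Lemma sc_sum c (I : Type) (r : seq I) (P : pred I) (F : I -> M) : zpl p c ->
  sc c (\sum_(i <- r | P i) F i) = \sum_(i <- r | P i) sc c (F i).
Proof. by move=> cZ; apply: big_morph; [move=> x y; rewrite scDr|rewrite sc0r]. Qed.
Lemma psi_sum j (I : Type) (r : seq I) (P : pred I) (F : I -> M) : zunit p j ->
  psi j (\sum_(i <- r | P i) F i) = \sum_(i <- r | P i) psi j (F i).
Proof. by move=> jU; apply: big_morph; [move=> x y; rewrite psiD|rewrite psi0]. Qed.
Lemma sc_nat n x : sc n%:R x = x *+ n.
Proof.
elim: n => [|n IHn]; first by rewrite sc0l.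
by rewrite -natr1 mulrSr scDl ?zpl_nat ?zpl1 // IHn sc1.
Qed.

(** This is F(Psi^q) x. The maps [sc] and [psi] are controlled only on p-local scalars and units,
    which is why the rules below ask for [F] over Z_(p). *)
Definition poly_act (F : {poly rat}) (x : M) : M :=
  \sum_(i < size F) sc F`_i (iter i (psi qr) x).

Lemma poly_act_widen n F x : (size F <= n)%N ->
  poly_act F x = \sum_(i < n) sc F`_i (iter i (psi qr) x).
Proof.
move=> sF; rewrite /poly_act (big_ord_widen n (fun i => sc F`_i (iter i (psi qr) x)) sF).
rewrite big_mkcond; apply: eq_bigr => i _; case: ltnP => // leFi.
by rewrite nth_default // sc0l.
Qed.

Lemma iter_psi i x : iter i (psi qr) x = psi (qr ^+ i) x.
Proof.
elim: i => [|i IHi]; first by rewrite psi1.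
by rewrite iterS IHi exprS psiM ?zunitX // qr_zunit.
Qed.

Lemma poly_actD F G x : F \is a Zp_poly -> G \is a Zp_poly ->
  poly_act (F + G) x = poly_act F x + poly_act G x.
Proof.
move=> /polyOverP FZ /polyOverP GZ.
rewrite !(@poly_act_widen (maxn (size F) (size G))) ?leq_maxl ?leq_maxr ?size_polyD //.
by rewrite -big_split; apply: eq_bigr => i _; rewrite coefD scDl //; [apply: FZ|apply: GZ].
Qed.

Lemma poly_act0 x : poly_act 0 x = 0.
Proof. by rewrite /poly_act size_poly0 big_ord0. Qed.

Lemma poly_actZ c F x : zpl p c -> F \is a Zp_poly ->
  poly_act (c *: F) x = sc c (poly_act F x).
Proof.
move=> cZ /polyOverP FZ; rewrite (@poly_act_widen (size F)) ?size_scale_leq //.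
rewrite /poly_act sc_sum //.
by apply: eq_bigr => i _; rewrite coefZ scM //; apply: FZ.
Qed.

Lemma poly_actMX F x : poly_act (F * 'X) x = poly_act F (psi qr x).
Proof.
rewrite (@poly_act_widen (size F).+1); last first.
  by rewrite (leq_trans (size_polyMleq _ _)) // size_polyX addn2.
rewrite big_ord_recl coefMX sc0l add0r.
by apply: eq_bigr => i _; rewrite coefMX iterSr.
Qed.

Lemma poly_actC c x : poly_act c%:P x = sc c x.
Proof. by rewrite (@poly_act_widen 1) ?size_polyC_leq1 // big_ord1 coefC. Qed.

Lemma poly_actMXaddC F c x : F \is a Zp_poly -> zpl p c ->
  poly_act (F * 'X + c%:P) x = poly_act F (psi qr x) + sc c x.
Proof.
by move=> FZ cZ; rewrite poly_actD ?poly_actMX ?poly_actC ?polyOverC ?rpredM ?polyOverX.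
Qed.

Lemma psi_poly_act j F x : zunit p j -> F \is a Zp_poly ->
  psi j (poly_act F x) = poly_act F (psi j x).
Proof.
move=> jU /polyOverP FZ; rewrite /poly_act psi_sum //; apply: eq_bigr => i _.
rewrite !iter_psi psi_sc //; last exact: FZ.
by rewrite -!psiM ?zunitX ?qr_zunit // mulrC.
Qed.

Lemma poly_actDr F x y : F \is a Zp_poly -> poly_act F (x + y) = poly_act F x + poly_act F y.
Proof.
move/polyOverP=> FZ; rewrite -big_split; apply: eq_bigr => i _ /=.
by rewrite !iter_psi psiD ?zunitX ?qr_zunit // scDr //; apply: FZ.
Qed.

Lemma poly_act0r F : F \is a Zp_poly -> poly_act F 0 = 0.
Proof. by move=> FZ; apply: (addrI (poly_act F 0)); rewrite -poly_actDr // !addr0. Qed.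

Lemma poly_act_sc c F x : zpl p c -> F \is a Zp_poly ->
  poly_act F (sc c x) = sc c (poly_act F x).
Proof.
move=> cZ /polyOverP FZ; rewrite /poly_act sc_sum //; apply: eq_bigr => i _.
have FiZ : zpl p F`_i by apply: FZ.
by rewrite !iter_psi psi_sc ?zunitX ?qr_zunit // -!scM // mulrC.
Qed.

Lemma poly_actM F G x : F \is a Zp_poly -> G \is a Zp_poly ->
  poly_act (F * G) x = poly_act F (poly_act G x).
Proof.
move=> FZ GZ; move: F FZ x; apply: polyOver_ind => [|F c FZ cZ IHF] x.
  by rewrite mul0r !poly_act0.
have -> : (F * 'X + c%:P) * G = F * G * 'X + c *: G.
  by rewrite -mul_polyC; ring.
rewrite poly_actD ?polyOverZ ?rpredM ?polyOverX // poly_actMX IHF poly_actZ //.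
by rewrite poly_actMXaddC // psi_poly_act // qr_zunit.
Qed.

Lemma poly_actB F G x : F \is a Zp_poly -> G \is a Zp_poly ->
  poly_act (F - G) x = poly_act F x - poly_act G x.
Proof.
move=> FZ GZ; rewrite -scaleN1r poly_actD ?polyOverZ ?poly_actZ ?zplN ?zpl1 //;
  last by apply: zplN; apply: zpl1.
by rewrite scNl ?zpl1 // sc1.
Qed.

Lemma poly_actX x : poly_act 'X x = psi qr x.
Proof. by rewrite -['X]mul1r poly_actMX -polyC1 poly_actC sc1. Qed.

Lemma poly_actXn n x : poly_act 'X^n x = psi (qr ^+ n) x.
Proof.
elim: n x => [|n IHn] x; first by rewrite !expr0 -polyC1 poly_actC sc1 psi1.
by rewrite exprSr poly_actMX IHn exprSr psiM ?zunitX // qr_zunit.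
Qed.

Lemma inRx_ind x (P : M -> Prop) :
  P 0 -> (forall y z, P y -> P z -> P (y + z)) ->
  (forall c j, zpl p c -> zunit p j -> P (sc c (psi j x))) ->
  forall y, inRx p sc psi x y -> P y.
Proof.
move=> P0 PD Psc _ [s [sU ->]].
elim: s sU => [|[c j] s IHs] sU; first by rewrite big_nil.
rewrite big_cons; apply: PD; first by case/andP: (sU _ (mem_head _ _)); apply: Psc.
by apply: IHs => cj cjs; apply: sU; rewrite inE cjs orbT.
Qed.

Lemma inRx0 x : inRx p sc psi x 0.
Proof. by exists [::]; split=> //; rewrite big_nil. Qed.

Lemma inRxD x y z : inRx p sc psi x y -> inRx p sc psi x z -> inRx p sc psi x (y + z).
Proof.
move=> [s [sU ->]] [t [tU ->]]; exists (s ++ t); split; last by rewrite big_cat.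
by move=> cj; rewrite mem_cat => /orP[/sU|/tU].
Qed.

Lemma inRx_scpsi c j x : zpl p c -> zunit p j -> inRx p sc psi x (sc c (psi j x)).
Proof.
move=> cZ jU; exists [:: (c, j)]; split; last by rewrite big_seq1.
by move=> _ /[!inE]/eqP->; rewrite cZ.
Qed.

Lemma inRx_refl x : inRx p sc psi x x.
Proof. by rewrite -{2}[x]sc1 -{2}[x]psi1; apply: inRx_scpsi; rewrite ?zpl1 ?zunit1. Qed.

Lemma inRx_trans x y z : inRx p sc psi x y -> inRx p sc psi y z -> inRx p sc psi x z.
Proof.
move=> xy; move: z; apply: inRx_ind => [|u v|c j cZ jU]; [exact: inRx0|exact: inRxD|].
move: y xy; apply: inRx_ind => [|u v xu xv|d k dZ kU].
- by rewrite psi0 // sc0r //; apply: inRx0.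
- by rewrite psiD // scDr //; apply: inRxD.
- by rewrite psi_sc // -scM // -psiM //; apply: inRx_scpsi; rewrite ?zplM ?zunitM.
Qed.

Lemma inRx_sc c x y : zpl p c -> inRx p sc psi x y -> inRx p sc psi x (sc c y).
Proof.
move=> cZ /inRx_trans; apply; rewrite -[y in sc c y]psi1.
by apply: inRx_scpsi => //; apply: zunit1.
Qed.

Lemma inRxB x y z : inRx p sc psi x y -> inRx p sc psi x z -> inRx p sc psi x (y - z).
Proof.
move=> xy xz; apply: inRxD => //.
by rewrite -[z]sc1 -scNl ?zpl1 //; apply: inRx_sc => //; rewrite zplN // zpl1.
Qed.

Lemma inRx_poly_act F x : F \is a Zp_poly -> inRx p sc psi x (poly_act F x).
Proof.
move/polyOverP=> FZ; apply: (big_ind (inRx p sc psi x)) => [||i _].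
- exact: inRx0.
- exact: inRxD.
- by rewrite iter_psi; apply: inRx_scpsi; [apply: FZ|rewrite zunitX // qr_zunit].
Qed.

End RModules.

(** * Discrete A-modules *)

Lemma locally_polyD f g : locally_poly f -> locally_poly g ->
  locally_poly (fun i => f i + g i).
Proof.
move=> fP gP m; have [F FZ fF] := fP m; have [G GZ gG] := gP m.
exists (F + G); first by rewrite rpredD.
by move=> i ltim; rewrite fF // gG // /eval_nodes hornerD.
Qed.

Lemma locally_polyM f g : locally_poly f -> locally_poly g ->
  locally_poly (fun i => f i * g i).
Proof.
move=> fP gP m; have [F FZ fF] := fP m; have [G GZ gG] := gP m.
exists (F * G); first by rewrite rpredM.
by move=> i ltim; rewrite fF // gG // /eval_nodes hornerM.
Qed.

Lemma locally_polyC c : zpl p c -> locally_poly (constA c).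
Proof.
move=> cZ m; exists c%:P; first by rewrite polyOverC.
by move=> i _; rewrite /eval_nodes hornerC.
Qed.

Lemma locally_polyB f g : locally_poly f -> locally_poly g ->
  locally_poly (fun i => f i - g i).
Proof.
move=> fP gP m; have [F FZ fF] := fP m; have [G GZ gG] := gP m.
exists (F - G); first by rewrite rpredB.
by move=> i ltim; rewrite fF // gG // /eval_nodes hornerD hornerN.
Qed.

Section AModules.
Variables (M : zmodType) (act : (nat -> rat) -> M -> M).
Hypothesis AM : isAmodule p q act.
Implicit Types (F G : {poly rat}) (x y z : M).
Local Notation sc := (fun c => act (constA c)).
Local Notation psi := (fun j => act (psiA q j)).

Lemma actDl f g x : inA p q f -> inA p q g ->
  act (fun i => f i + g i) x = act f x + act g x.
Proof. by case: AM => H _; apply: H. Qed.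
Lemma actDr f x y : inA p q f -> act f (x + y) = act f x + act f y.
Proof. by case: AM => _ [H _]; apply: H. Qed.
Lemma actM f g x : inA p q f -> inA p q g ->
  act (fun i => f i * g i) x = act f (act g x).
Proof. by case: AM => _ [_ [H _]]; apply: H. Qed.
Lemma act1 x : act (fun=> 1) x = x.
Proof. by case: AM => _ [_ [_ H]]; apply: H. Qed.

Lemma constA_inA c : zpl p c -> inA p q (constA c).
Proof. by move=> cZ; apply/inA_locally_poly/locally_polyC. Qed.

Lemma act_isRmodule : isRmodule p sc psi.
Proof.
have cA := constA_inA; have pA := psiA_inA.
do !split.
- by move=> c d x cZ dZ; rewrite -actDl //; apply: cA.
- by move=> c x y cZ; rewrite actDr //; apply: cA.
- by move=> c d x cZ dZ; rewrite -actM //; apply: cA.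
- exact: act1.
- by move=> j x y jU; rewrite actDr //; apply: pA.
- move=> j c x jU cZ; rewrite -!actM; try by [apply: cA|apply: pA].
  by congr act; apply: functional_extensionality => i; rewrite mulrC.
- move=> x; rewrite -[RHS]act1; congr act; apply: functional_extensionality => i.
  by rewrite /psiA exp1rz.
- move=> j k x jU kU; rewrite -actM; try exact: pA.
  congr act; apply: functional_extensionality => i.
  by rewrite /psiA expfzMl.
Qed.
Let RM := act_isRmodule.

(** [psiA q qr] takes the value [nd i] at [i], so it is the image of X in A; Horner induction does
    the rest. *)
Lemma act_eval_nodes F x : F \is a Zp_poly -> act (eval_nodes F) x = poly_act sc psi F x.
Proof.
move=> FZ; move: F FZ x; apply: polyOver_ind => [|F c FZ cZ IHF] x.
  rewrite poly_act0 -(sc0l RM x) /=; congr act; apply: functional_extensionality => i.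
  by rewrite /eval_nodes horner0.
rewrite (poly_actMXaddC RM) // -IHF -actM; [|exact: eval_nodes_inA|exact: psiA_inA qr_zunit].
rewrite -actDl; [|apply/inA_locally_poly|exact: constA_inA].
  congr act; apply: functional_extensionality => i.
  by rewrite /eval_nodes hornerMXaddC.
by apply: locally_polyM; apply/inA_locally_poly; [apply: eval_nodes_inA|apply: psiA_inA qr_zunit].
Qed.

Lemma act_agree n x : (forall f, inAn p q n f -> act f x = 0) ->
  forall f g, inA p q f -> inA p q g -> (forall i, (i < n)%N -> f i = g i) ->
  act f x = act g x.
Proof.
move=> An0 f g fA gA fg; have [/inA_locally_poly fP /inA_locally_poly gP] := (fA, gA).
have -> : f = (fun i => g i + (f i - g i)).
  by apply: functional_extensionality => i; rewrite addrC subrK.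
have dA : inAn p q n (fun i => f i - g i).
  apply/inAn_locally_poly; split=> [|i ltin]; first exact: locally_polyB.
  by rewrite fg // subrr.
by rewrite actDl ?(An0 _ dA) ?addr0 //; apply: inAnW dA.
Qed.

(** The action of all of A on [x] is thus determined by Psi^q and the scalars. *)
Lemma act_poly_act n x : (forall f, inAn p q n f -> act f x = 0) ->
  forall f F, inA p q f -> F \is a Zp_poly ->
  (forall i, (i < n)%N -> f i = eval_nodes F i) -> act f x = poly_act sc psi F x.
Proof.
move=> An0 f F fA FZ fF; rewrite -act_eval_nodes //.
by apply: (act_agree An0) => //; apply: eval_nodes_inA.
Qed.

Hypothesis discM : discreteA p q act.

Lemma inRx_act x y : inRx p sc psi x y -> exists2 f, inA p q f & y = act f x.
Proof.
move: y; apply: inRx_ind => [|_ _ [f fA ->] [g gA ->]|c j cZ jU].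
- by exists (constA 0); [apply/constA_inA/zpl0|rewrite (sc0l RM)].
- exists (fun i => f i + g i); last by rewrite actDl.
  by apply/inA_locally_poly/locally_polyD; apply/inA_locally_poly.
- exists (fun i => constA c i * psiA q j i).
    by apply/inA_locally_poly/locally_polyM;
      apply/inA_locally_poly; [apply: constA_inA|apply: psiA_inA].
  by rewrite actM //; [apply: constA_inA|apply: psiA_inA].
Qed.

(** Collapses the operator of axiom (b) into one element of A, whose vanishing can be read off at
    the nodes. *)
Lemma act_foldr j (ls : seq rat) y : zunit p j -> {subset ls <= zpl p} ->
  let g i := \prod_(l <- ls) (psiA q j i - l) in
  inA p q g /\ foldr (fun l z => psi j z - sc l z) y ls = act g y.
Proof.
move=> jU; elim: ls => [|l ls IHls] lsZ /=.
  have -> : (fun i => \prod_(l <- [::]) (psiA q j i - l)) = constA 1.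
    by apply: functional_extensionality => i; rewrite big_nil.
  by split; [apply/constA_inA/zpl1|rewrite [RHS]act1].
have [|gA ->] := IHls; first by move=> l' ls'; apply: lsZ; rewrite inE ls' orbT.
have lZ : zpl p l by apply: lsZ; rewrite mem_head.
set g := fun i => _ in gA *.
have -> : (fun i => \prod_(l0 <- l :: ls) (psiA q j i - l0)) =
    (fun i => (psiA q j i + constA (- l) i) * g i).
  by apply: functional_extensionality => i; rewrite big_cons.
have hA : inA p q (fun i => psiA q j i + constA (- l) i).
  by apply/inA_locally_poly/locally_polyD; [apply/inA_locally_poly/psiA_inA|apply/locally_polyC/zplN].
split; first by apply/inA_locally_poly/locally_polyM; apply/inA_locally_poly.
rewrite actM // actDl; [|exact: psiA_inA|exact/constA_inA/zplN].
by rewrite -(scNl RM).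
Qed.

Lemma discrete_bousfield : bousfield p sc psi.
Proof.
split=> // x; have [n An0] := discM x.
split; [|split].
(* Axiom (a): [f] acts as an interpolant of size at most [n], so the first [n] iterates of Psi^q on
   [x] generate. *)
- exists (mkseq (fun i => iter i (psi qr) x) n).
  split=> [_ /mapP[i _ ->]|y /inRx_act[f fA ->]].
    rewrite (iter_psi RM) -[act _ _](sc1 RM).
    by apply: inRx_scpsi; rewrite ?zpl1 // zunitX // qr_zunit.
  have fP : locally_poly f by apply/inA_locally_poly.
  have [F /and3P[FZ sF /forallP fF]] := locally_poly_small fP n.
  exists (mkseq (fun i => F`_i) n); rewrite !size_mkseq; split=> //; split.
    by move=> _ /mapP[i _ ->]; apply: (polyOverP FZ).
  rewrite (act_poly_act An0 fA FZ) => [|i ltin]; last exact: eqP (fF (Ordinal ltin)).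
  rewrite (poly_act_widen RM _ sF); apply: eq_bigr => i _.
  by rewrite !nth_mkseq.
(* Axiom (b): these exponents give the values of Psi^j at the first [n] nodes, so the product
   vanishes there and lies in A_n. It kills [y] itself, hence the multiple 1. *)
- move=> j jU; exists [seq qexp i.+1 | i <- iota 0 n] => y /inRx_act[f fA ->].
  exists 1%N; split=> //; rewrite mulr1n.
  set ls := undup _.
  have [|gA ->] := @act_foldr j ls (act f x) jU.
    move=> l; rewrite mem_undup => /mapP[k _ ->].
    by apply/zunit_zpl/zunit_exprz.
  rewrite -actM // An0 //; apply/inAn_locally_poly; split.
    by apply: locally_polyM; apply/inA_locally_poly.
  move=> i ltin; rewrite (big_rem (psiA q j i)) /=; last first.
    by rewrite mem_undup; do 2!apply: map_f; rewrite mem_iota.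
  by rewrite subrr !mul0r.
(* Axiom (c): [j] and [j'] are close to the same q^s, so both operations are X^s modulo p^m at the
   nodes, and X^s cancels in the difference. *)
- move=> m m0; have [N appN] := psiA_approx n.
  exists (N + m)%N => j j' jU j'U jj' y /inRx_act[f fA ->].
  have [s js] := zunit_approx (N + m) jU.
  have j's : zpl p ((j' - qr ^+ s) / pi ^+ (N + m)).
    rewrite (_ : _ / _ = (j - qr ^+ s) / pi ^+ (N + m) - (j - j') / (p ^ (N + m))%:R).
      exact: zplB.
    by rewrite natrX -mulrBl; congr (_ / _); ring.
  have [F FZ jF] := appN m j s jU js.
  have [F' F'Z j'F'] := appN m j' s j'U j's.
  (* A_n is an ideal of a commutative ring, so it kills [act f x] along with [x]. *)
  have An0' h : inAn p q n h -> act h (act f x) = 0.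
    move=> /inAn_locally_poly[hP h0]; rewrite -actM //; last exact/inA_locally_poly.
    apply: An0; apply/inAn_locally_poly; split; first exact/locally_polyM/inA_locally_poly.
    by move=> i ltin; rewrite h0 // mul0r.
  exists (poly_act sc psi (F - F') (act f x)); split.
    apply: (inRx_trans RM (y := act f x)).
      have fP : locally_poly f by apply/inA_locally_poly.
      have [G GZ fG] := fP n.
      by rewrite (act_poly_act An0 fA GZ fG); apply: inRx_poly_act.
    by apply: inRx_poly_act => //; rewrite rpredB.
  have pZ : zpl p (pi ^+ m) by apply/zplX/zpl_nat.
  have XFZ G : G \is a Zp_poly -> 'X^s + pi ^+ m *: G \is a Zp_poly.
    by move=> GZ; rewrite rpredD ?polyOverXn // polyOverZ.
  rewrite (act_poly_act An0' (psiA_inA jU) (XFZ _ FZ) jF).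
  rewrite (act_poly_act An0' (psiA_inA j'U) (XFZ _ F'Z) j'F').
  rewrite natrX -(poly_actB RM) ?XFZ // opprD addrACA subrr add0r -scalerBr.
  by rewrite (poly_actZ RM) ?rpredB.
Qed.

End AModules.

(** * Uniqueness of the action and A-linearity of R-linear maps *)

Lemma poly_act_ext (M : zmodType) (sc psi sc' psi' : rat -> M -> M) (F : {poly rat}) x :
  (forall c x, zpl p c -> sc c x = sc' c x) ->
  (forall j x, zunit p j -> psi j x = psi' j x) ->
  F \is a Zp_poly -> poly_act sc psi F x = poly_act sc' psi' F x.
Proof.
move=> scE psiE /polyOverP FZ; apply: eq_bigr => i _.
rewrite scE; last exact: FZ.
by congr sc'; apply: eq_iter => y; rewrite psiE // qr_zunit.
Qed.

(** One interpolant of [f], at enough nodes for both annihilators of [x], computes both actions. *)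
Lemma discrete_act_unique (M : zmodType) (sc psi : rat -> M -> M)
    (act1 act2 : (nat -> rat) -> M -> M) :
  isAmodule p q act1 -> discreteA p q act1 ->
  (forall c x, zpl p c -> act1 (constA c) x = sc c x) ->
  (forall j x, zunit p j -> act1 (psiA q j) x = psi j x) ->
  isAmodule p q act2 -> discreteA p q act2 ->
  (forall c x, zpl p c -> act2 (constA c) x = sc c x) ->
  (forall j x, zunit p j -> act2 (psiA q j) x = psi j x) ->
  forall f x, inA p q f -> act1 f x = act2 f x.
Proof.
move=> AM1 disc1 sc1 psi1 AM2 disc2 sc2 psi2 f x fA.
have [[n1 An1] [n2 An2]] := (disc1 x, disc2 x).
have fP : locally_poly f by apply/inA_locally_poly.
have [F FZ fF] := fP (maxn n1 n2).
rewrite (act_poly_act AM1 An1 fA FZ) => [|i lti]; last by rewrite fF // leq_max lti.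
rewrite (act_poly_act AM2 An2 fA FZ) => [|i lti]; last by rewrite fF // leq_max lti orbT.
by apply: poly_act_ext => // [c y cZ|j y jU]; rewrite ?sc1 ?sc2 ?psi1 ?psi2.
Qed.

(** The same argument, with enough nodes for [x] and for [h x]; [h] commutes with polynomials in
    Psi^q. *)
Lemma discrete_morphism (M N : zmodType) (actM : (nat -> rat) -> M -> M)
    (actN : (nat -> rat) -> N -> N) (h : M -> N) :
  isAmodule p q actM -> discreteA p q actM ->
  isAmodule p q actN -> discreteA p q actN ->
  (forall x y, h (x + y) = h x + h y) ->
  (forall c x, zpl p c -> h (actM (constA c) x) = actN (constA c) (h x)) ->
  (forall j x, zunit p j -> h (actM (psiA q j) x) = actN (psiA q j) (h x)) ->
  forall f x, inA p q f -> h (actM f x) = actN f (h x).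
Proof.
move=> AM discM AN discN hD hsc hpsi f x fA.
have [[n1 An1] [n2 An2]] := (discM x, discN (h x)).
have fP : locally_poly f by apply/inA_locally_poly.
have [F FZ fF] := fP (maxn n1 n2).
rewrite (act_poly_act AM An1 fA FZ) => [|i lti]; last by rewrite fF // leq_max lti.
rewrite (act_poly_act AN An2 fA FZ) => [|i lti]; last by rewrite fF // leq_max lti orbT.
have h0 : h 0 = 0 by apply: (addrI (h 0)); rewrite -hD !addr0.
rewrite /poly_act (big_morph h hD h0); apply: eq_bigr => i _.
rewrite hsc; last exact: (polyOverP FZ).
congr (actN _ _); elim: (i : nat) => [//|k IHk].
by rewrite !iterS hpsi ?qr_zunit // IHk.
Qed.

(** * Bousfield modules *)

Lemma prod_qr_split_pow a m : exists2 H, H \is a Zp_poly &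
  \prod_(e <- iota a (m * p.-1)) ('X - (qr ^+ e)%:P)
    = ('X^(p.-1) - 1) ^+ m + pi *: H.
Proof.
elim: m a => [|m IHm] a.
  by exists 0; rewrite ?rpred0 // big_nil expr0 scaler0 addr0.
have XZ : 'X^(p.-1) - 1 \is a Zp_poly by rewrite rpredB ?rpred1 ?polyOverXn.
have [G GZ eG] := prod_qr_split a; have [H HZ eH] := IHm (a + p.-1)%N.
exists (('X^(p.-1) - 1) * H + G * ('X^(p.-1) - 1) ^+ m + pi *: (G * H)).
  have pZ : pi \in zpl p by apply: zpl_nat.
  by rewrite !rpredD ?rpredM ?rpredX // polyOverZ ?rpredM.
rewrite mulSn iotaD big_cat eG eH exprS /= -!mul_polyC; ring.
Qed.

Lemma nd_double e : (0 < e)%N -> nd e.*2.-1 = qr ^+ e.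
Proof.
move=> e0; rewrite /= prednK ?double_gt0 // /qq /qexp doubleK.
by rewrite -signr_odd odd_double expr0 mul1r.
Qed.

Lemma theta_poly_block k n : exists n' U H, [/\ U \is a Zp_poly, H \is a Zp_poly
  & theta_poly n' = (U * ('X^(p.-1 * p ^ k) - 1) + pi *: H) * theta_poly n].
Proof.
(* The power q^e with e > 0 is the node of index [e.*2.-1]. For exponents from [n.+1] on these
   indices lie beyond the first [n], and [n'] leaves room for [K] of them; the other new nodes go
   into the cofactor. *)
pose K := (p ^ k * p.-1)%N; pose n' := (n.+1 + K).*2.
pose js := iota 0 n ++ [seq e.*2.-1 | e <- iota n.+1 K].
have js_uniq : uniq js.
  rewrite cat_uniq iota_uniq map_inj_in_uniq ?iota_uniq ?andbT /=.
    apply/hasPn => _ /mapP[e + ->]; rewrite !mem_iota; lia.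
  by move=> e e'; rewrite !mem_iota; lia.
have [G GZ eG] : exists2 G, G \is a Zp_poly &
    theta_poly n' = G * \prod_(a <- [seq nd i | i <- js]) ('X - a%:P).
  apply: polyOver_roots (theta_poly_zpl n') _; first by rewrite map_inj_uniq //; apply: nd_inj.
    by move=> _ /mapP[i _ ->]; apply/zunit_zpl/nd_zunit.
  move=> _ /mapP[i + ->]; rewrite mem_cat => /orP[|/mapP[e + ->]];
    by rewrite mem_iota => ?; apply: theta_poly_node; rewrite /n'; lia.
have [H HZ eH] := prod_qr_split_pow n.+1 (p ^ k).
have [H' H'Z eH'] := zpl_freshmanXn p.-1 k.
exists n', G, (G * (H' + H)); split=> //; first by rewrite rpredM ?rpredD.
rewrite eG map_cat big_cat -/(theta_poly n) -map_comp /= big_map.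
rewrite (eq_big_seq (fun e => 'X - (qr ^+ e)%:P)); last first.
  by move=> e; rewrite mem_iota => /andP[/(leq_ltn_trans (leq0n n)) e0 _] /=;
    rewrite nd_double.
by rewrite eH eH' -!mul_polyC; ring.
Qed.

(** Hence every eigenvalue that axiom (b) allows for Psi^q is a root of some Theta_n. *)
Lemma nd_surj (e : int) : exists i, qr ^ e = nd i.
Proof.
case: e => e.
  have [->|e0] := posnP e; first by exists 0.
  by exists e.*2.-1; rewrite nd_double.
exists e.+1.*2; rewrite /qq /qexp -signr_odd [odd _]/= odd_double.
by rewrite expr1 mulN1r NegzE -[_./2]/(uphalf e.+1.*2) uphalf_double.
Qed.

Lemma theta_poly_mono m n : (m <= n)%N ->
  exists2 G, G \is a Zp_poly & theta_poly n = G * theta_poly m.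
Proof.
move=> le_mn; apply: theta_poly_dvd (theta_poly_zpl n) _ => i ltim.
by rewrite theta_poly_node // (leq_trans ltim).
Qed.

Section BousfieldModules.
Variables (M : zmodType) (sc psi : rat -> M -> M).
Hypothesis RM : isRmodule p sc psi.
Implicit Types (F G : {poly rat}) (x y z w : M).
Local Notation poly_act := (poly_act sc psi).

(** Recursive on the generators, to suit the induction in [in_span_cap]. *)
Fixpoint in_span (gs : seq M) (y : M) : Prop :=
  if gs is g :: gs' then
    exists c z, [/\ zpl p c, in_span gs' z & y = sc c g + z]
  else y = 0.

Lemma in_span_sc gs c y : zpl p c -> in_span gs y -> in_span gs (sc c y).
Proof.
move=> cZ; elim: gs y => [|g gs IHgs] y /=; first by move->; rewrite (sc0r RM).
move=> [d [z [dZ zS ->]]]; exists (c * d), (sc c z); split; rewrite ?zplM //.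
  exact: IHgs.
by rewrite (scDr RM) // (scM RM).
Qed.

Lemma in_spanD gs y z : in_span gs y -> in_span gs z -> in_span gs (y + z).
Proof.
elim: gs y z => [|g gs IHgs] y z /=; first by move=> -> ->; rewrite addr0.
move=> [c [u [cZ uS ->]]] [d [v [dZ vS ->]]]; exists (c + d), (u + v).
by rewrite zplD // (scDl RM) // addrACA; split=> //; apply: IHgs.
Qed.

Lemma in_spanB gs y z : in_span gs y -> in_span gs z -> in_span gs (y - z).
Proof.
move=> yS zS; apply: in_spanD => //.
rewrite -[z](sc1 RM) -(scNl RM) ?zpl1 //.
by apply: in_span_sc => //; apply: zplN; apply: zpl1.
Qed.

Lemma in_span_sum (gs : seq M) (cs : seq rat) :
  size cs = size gs -> (forall c, c \in cs -> zpl p c) ->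
  in_span gs (\sum_(i < size gs) sc (nth 0 cs i) (nth 0 gs i)).
Proof.
elim: gs cs => [|g gs IHgs] [|c cs] //= => [_ _|[scs] csZ]; first by rewrite big_ord0.
exists c, (\sum_(i < size gs) sc (nth 0 cs i) (nth 0 gs i)); split.
- by apply: csZ; rewrite mem_head.
- by apply: IHgs => // d dcs; apply: csZ; rewrite inE dcs orbT.
- by rewrite big_ord_recl.
Qed.

(* Krull's intersection theorem over the discrete valuation ring Z_(p), by
   induction on the generators: modulo the other ones the first generator
   either is killed by a power of p or generates a free module. *)
Lemma in_span_cap gs y :
  (forall m, exists2 z, in_span gs z & y = sc (pi ^+ m) z) -> y = 0.
Proof.
have pZ m : zpl p (pi ^+ m) by apply/zplX/zpl_nat.
elim: gs y => [|g gs IHgs] y yS; first by case: (yS 0%N) => z -> ->; rewrite (sc0r RM).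
case: (classic (exists t, in_span gs (sc (pi ^+ t) g))) => [[t gS]|gN].
  apply: IHgs => m; have [_ [c [z [cZ zS ->]]] ->] := yS (m + t)%N.
  exists (sc c (sc (pi ^+ t) g) + sc (pi ^+ t) z).
    by apply: in_spanD; apply: in_span_sc.
  rewrite !(scDr RM) // -!(scM RM) ?zplM //.
  by rewrite exprD; congr (sc _ _ + _); ring.
have gfree c : zpl p c -> in_span gs (sc c g) -> c = 0.
  move=> cZ cS; apply/eqP/negPn/negP => c0.
  have [t [u [uU ec]]] := zpl_uniformizer cZ c0.
  case: gN; exists t.
  have -> : sc (pi ^+ t) g = sc u^-1 (sc c g).
    rewrite -(scM RM) //; last by case/and3P: uU.
    by rewrite ec mulrCA mulVf ?mulr1 // zunit_neq0.
  by apply: in_span_sc => //; case/and3P: uU.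
have [_ [c0 [z0 [c0Z z0S ->]]] ey] := yS 0%N.
rewrite expr0 (sc1 RM) in ey.
(* Freeness forces the coefficient of [g] to be the same [c0] for every [m], so that [c0] is
   divisible by all powers of p. *)
have ycm m : exists c z, [/\ zpl p c, in_span gs z, c0 = pi ^+ m * c
    & y = sc (pi ^+ m * c) g + sc (pi ^+ m) z].
  have [_ [c [z [cZ zS ->]]] eym] := yS m; exists c, z.
  rewrite (scDr RM) // -(scM RM) // in eym; split=> //.
  apply/eqP; rewrite -subr_eq0; apply/eqP/gfree; first by rewrite zplB ?zplM.
  have -> : sc (c0 - pi ^+ m * c) g = sc (pi ^+ m) z - z0.
    rewrite (scDl RM) ?zplN ?zplM // (scNl RM) ?zplM //.
    apply/eqP; rewrite subr_eq addrAC -subr_eq opprK -ey eym addrC.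
    by rewrite (addrC (sc _ g)).
  by apply: in_spanB => //; apply: in_span_sc.
have c00 : c0 = 0.
  apply: zpl_div_all => m; have [c [z [cZ _ -> _]]] := ycm m.
  by rewrite mulrAC divff ?piX_neq0 // mul1r.
apply: IHgs => m; have [c [z [cZ zS ec ->]]] := ycm m.
by exists z => //; rewrite -ec c00 (sc0l RM) add0r.
Qed.

Lemma poly_act_foldr (ls : seq rat) x : {subset ls <= zpl p} ->
  foldr (fun l z => psi qr z - sc l z) x ls
    = poly_act (\prod_(l <- ls) ('X - l%:P)) x.
Proof.
elim: ls => [|l ls IHls] lsZ; first by rewrite big_nil -polyC1 poly_actC // (sc1 RM).
have lZ : zpl p l by apply: lsZ; rewrite mem_head.
have {}lsZ : {subset ls <= zpl p}.
  by move=> l' ls'; apply: lsZ; rewrite inE ls' orbT.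
rewrite big_cons /= IHls // (poly_actM RM) ?polyOverXsubC ?polyOver_prodXsubC //.
by rewrite (poly_actB RM) ?polyOverX ?polyOverC // (poly_actX RM) (poly_actC RM).
Qed.

(** Induction on [s]: since Psi^q to the power (p-1)p^k fixes [w], a block acts on [w] as p times a
    polynomial. The result is again fixed and is killed by one power of p less; the next block
    starts where this one ends. *)
Lemma poly_act_kill k s n w : sc (pi ^+ s) w = 0 ->
  psi (qr ^+ (p.-1 * p ^ k)) w = w ->
  exists n' G, [/\ G \is a Zp_poly, theta_poly n' = G * theta_poly n & poly_act G w = 0].
Proof.
elim: s n w => [|s IHs] n w sw qw.
  exists n, 1; rewrite rpred1 mul1r; split=> //.
  by rewrite -polyC1 (poly_actC RM) -[RHS]sw expr0.
have [n1 [U [H [UZ HZ en1]]]] := theta_poly_block k n.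
have pZ : zpl p pi by apply: zpl_nat.
have w1E : poly_act (U * ('X^(p.-1 * p ^ k) - 1) + pi *: H) w = sc pi (poly_act H w).
  rewrite (poly_actD RM) ?polyOverZ ?rpredM ?rpredB ?rpred1 ?polyOverXn //.
  rewrite (poly_actM RM) ?rpredB ?rpred1 ?polyOverXn //.
  rewrite (poly_actB RM) ?rpred1 ?polyOverXn // (poly_actXn RM) qw.
  by rewrite -polyC1 (poly_actC RM) (sc1 RM) subrr (poly_act0r RM) // add0r (poly_actZ RM).
set w1 := sc pi (poly_act H w) in w1E.
have [||n2 [G [GZ en2 Gw1]]] := IHs n1 w1.
- rewrite /w1 -(scM RM) ?zplX // -exprSr -(poly_act_sc RM) ?zplX //.
  by rewrite sw (poly_act0r RM).
- rewrite /w1 (psi_sc RM) ?zunitX ?qr_zunit //.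
  by rewrite (psi_poly_act RM) ?zunitX ?qr_zunit // qw.
exists n2, (G * (U * ('X^(p.-1 * p ^ k) - 1) + pi *: H)).
have FZ : U * ('X^(p.-1 * p ^ k) - 1) + pi *: H \is a Zp_poly.
  by rewrite rpredD ?polyOverZ ?rpredM ?rpredB ?rpred1 ?polyOverXn.
by rewrite (poly_actM RM) // w1E en2 en1 mulrA; split=> //; rewrite rpredM.
Qed.

Hypothesis BM : bousfield p sc psi.

Lemma bousfield_theta_poly x : exists n, poly_act (theta_poly n) x = 0.
Proof.
have [_ /(_ x)[_ [/(_ _ qr_zunit)[ks ksP] _]]] := BM.
have [n0 [n00 tors]] := ksP x (inRx_refl RM x).
set ls := undup _ in tors.
have lsZ : {subset ls <= zpl p}.
  move=> l; rewrite mem_undup => /mapP[k _ ->].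
  exact/zunit_zpl/zunit_exprz/qr_zunit.
(* Axiom (b) is used for j = q, where the eigenvalues are nodes, so finitely many nodes contain them
   all. *)
have [n1 lsn1] : exists n, {subset ls <= nodes n}.
  have : forall l, l \in ls -> exists i, l = nd i.
    by move=> l; rewrite mem_undup => /mapP[k _ ->]; apply: nd_surj.
  elim: (ls) => [|l r IHr] rE; first by exists 0.
  have [|n rn] := IHr; first by move=> l' l'r; apply: rE; rewrite inE l'r orbT.
  have [i ->] := rE l (mem_head _ _).
  exists (maxn n i.+1) => a; rewrite inE => /predU1P[->|/rn/mapP[j + ->]].
    by apply: mem_nodes; rewrite leq_max ltnSn orbT.
  by rewrite mem_iota => /andP[_ ltjn]; apply: mem_nodes; rewrite leq_max ltjn.
have [G GZ en1] : exists2 G, G \is a Zp_poly &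
    theta_poly n1 = G * \prod_(a <- ls) ('X - a%:P).
  apply: polyOver_roots (undup_uniq _) lsZ (theta_poly_zpl n1) _.
  move=> a /lsn1/mapP[i + ->]; rewrite mem_iota => /andP[_ ?]; exact: theta_poly_node.
set w := poly_act (theta_poly n1) x.
have n0Z : zpl p n0%:R by apply: zpl_nat.
have n0w : sc n0%:R w = 0.
  rewrite /w en1 (poly_actM RM) ?polyOver_prodXsubC // -poly_act_foldr // -(poly_act_sc RM) //.
  by rewrite (sc_nat RM) tors (poly_act0r RM).
(* Up to a unit of Z_(p), [n0] is p^s, so p^s already kills [w]. *)
have [|s [u [uU en0]]] := zpl_uniformizer n0Z; first by rewrite pnatr_eq0 -lt0n.
have pZ m : zpl p (pi ^+ m) by apply/zplX/zpl_nat.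
have sw m : (s <= m)%N -> sc (pi ^+ m) w = 0.
  move=> lesm; have uVZ : zpl p u^-1 by case/and3P: uU.
  have -> : pi ^+ m = pi ^+ (m - s) * u^-1 * n0%:R.
    rewrite -{1}(subnK lesm) exprD en0; field; exact: zunit_neq0 uU.
  by rewrite (scM RM) ?zplM // n0w (sc0r RM) // zplM.
(* Axiom (c) asks for a positive exponent, hence [s.+1]. As this power of p kills all of R w, the
   congruence it yields between (Psi^q)^((p-1)p^k) and the identity on [w] is an equality. *)
have [_ /(_ w)[_ [_ /(_ s.+1 isT)[k kP]]]] := BM.
have qw : psi (qr ^+ (p.-1 * p ^ k)) w = w.
  apply/eqP; rewrite -subr_eq0 -[X in _ - X](psi1 RM).
  have [|z [zw ->]] := kP _ _ (zunitX (p.-1 * p ^ k) qr_zunit) zunit1 _ w (inRx_refl RM w).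
    have [v [ev _]] := q_lift k.
    have -> : qr ^+ (p.-1 * p ^ k) - 1 = pi ^+ k * (pi * v%:~R).
      rewrite -rmorphXn /= ev rmorphD rmorphM rmorphXn /= -pmulrn exprS; ring.
    by rewrite natrX mulrAC divff ?piX_neq0 // mul1r zplM ?zpl_nat ?zpl_int.
  apply/eqP; rewrite natrX; move: z zw; apply: inRx_ind => [|y z y0 z0|c j cZ jU].
  - by rewrite (sc0r RM).
  - by rewrite (scDr RM) // y0 z0 addr0.
  - rewrite -(scM RM) // mulrC (scM RM) // -(psi_sc RM) // sw ?leqnSn //.
    by rewrite (psi0 RM) // (sc0r RM).
have [n' [F [FZ en' Fw]]] := poly_act_kill n1 (sw s (leqnn s)) qw.
by exists n'; rewrite en' (poly_actM RM) ?theta_poly_zpl.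
Qed.

Lemma poly_act_theta_poly_mono m n x : (m <= n)%N ->
  poly_act (theta_poly m) x = 0 -> poly_act (theta_poly n) x = 0.
Proof.
move=> /theta_poly_mono[G GZ ->] mx.
by rewrite (poly_actM RM) ?theta_poly_zpl // mx (poly_act0r RM).
Qed.

Lemma poly_act_agree n x F G : poly_act (theta_poly n) x = 0 ->
  F \is a Zp_poly -> G \is a Zp_poly ->
  (forall i, (i < n)%N -> eval_nodes F i = eval_nodes G i) -> poly_act F x = poly_act G x.
Proof.
move=> nx FZ GZ FG; have [|i ltin|H HZ eH] := @theta_poly_dvd n (F - G).
- by rewrite rpredB.
- by rewrite hornerD hornerN -/(eval_nodes F i) FG // subrr.
apply/eqP; rewrite -subr_eq0 -(poly_actB RM) // eH (poly_actM RM) ?theta_poly_zpl // nx.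
by rewrite (poly_act0r RM).
Qed.

(** The pair [n], [F] is not canonical, so a value is chosen; it is arbitrary when no pair exists,
    which does not happen for [f] in A. *)
Definition bousfield_act (f : nat -> rat) (x : M) : M :=
  epsilon (inhabits 0) (fun y => exists n F, [/\ F \is a Zp_poly,
    poly_act (theta_poly n) x = 0, (forall i, (i < n)%N -> f i = eval_nodes F i)
    & y = poly_act F x]).

(** Independence of the choice: the chosen and the given polynomial agree at the smaller of the two
    numbers of nodes, whose Theta kills [x]. *)
Lemma bousfield_actE n F f x : F \is a Zp_poly -> poly_act (theta_poly n) x = 0 ->
  (forall i, (i < n)%N -> f i = eval_nodes F i) -> bousfield_act f x = poly_act F x.
Proof.
move=> FZ nx fF; rewrite /bousfield_act.
set P := fun y => _.
have : exists y, P y by exists (poly_act F x), n, F.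
move/(epsilon_spec (inhabits 0)) => [n' [F' [F'Z n'x fF' ->]]].
have [le|/ltnW le] := leqP n n'.
  by apply: (poly_act_agree nx) => // i ltin; rewrite -fF // -fF' // (leq_trans ltin).
by apply: (poly_act_agree n'x) => // i ltin; rewrite -fF' // -fF // (leq_trans ltin).
Qed.

Lemma bousfield_act_isAmodule : isAmodule p q bousfield_act.
Proof.
do !split.
- move=> f g x /inA_locally_poly fP /inA_locally_poly gP.
  have [n nx] := bousfield_theta_poly x.
  have [[F FZ fF] [G GZ gG]] := (fP n, gP n).
  rewrite (bousfield_actE FZ nx fF) (bousfield_actE GZ nx gG) -(poly_actD RM) //.
  apply: (bousfield_actE _ nx) => [|i ltin]; first by rewrite rpredD.
  by rewrite fF // gG // /eval_nodes hornerD.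
- move=> f x y /inA_locally_poly fP.
  have [[n nx] [m my]] := (bousfield_theta_poly x, bousfield_theta_poly y).
  have [F FZ fF] := fP (maxn n m).
  have {}nx := poly_act_theta_poly_mono (leq_maxl n m) nx.
  have {}my := poly_act_theta_poly_mono (leq_maxr n m) my.
  rewrite (bousfield_actE FZ nx fF) (bousfield_actE FZ my fF) -(poly_actDr RM) //.
  by apply: bousfield_actE fF; rewrite // (poly_actDr RM) ?theta_poly_zpl // nx my addr0.
- move=> f g x /inA_locally_poly fP /inA_locally_poly gP.
  have [n nx] := bousfield_theta_poly x.
  have [[F FZ fF] [G GZ gG]] := (fP n, gP n).
  (* Polynomials in Psi^q commute, so the same [n] serves for [poly_act G x]. *)
  have nGx : poly_act (theta_poly n) (poly_act G x) = 0.
    rewrite -(poly_actM RM) ?theta_poly_zpl // mulrC (poly_actM RM) ?theta_poly_zpl //.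
    by rewrite nx (poly_act0r RM).
  rewrite (bousfield_actE GZ nx gG) (bousfield_actE FZ nGx fF) -(poly_actM RM) //.
  apply: (bousfield_actE _ nx) => [|i ltin]; first by rewrite rpredM.
  by rewrite fF // gG // /eval_nodes hornerM.
- move=> x; have [n nx] := bousfield_theta_poly x.
  rewrite (bousfield_actE (F := 1%:P) _ nx) ?(poly_actC RM) ?(sc1 RM) ?polyOverC ?rpred1 //.
  by move=> i _; rewrite /eval_nodes hornerC.
Qed.

Lemma bousfield_act_discrete : discreteA p q bousfield_act.
Proof.
move=> x; have [n nx] := bousfield_theta_poly x; exists n => f /inAn_locally_poly[_ f0].
rewrite (bousfield_actE (F := 0) _ nx) ?rpred0 ?poly_act0 // => i ltin.
by rewrite f0 // /eval_nodes horner0.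
Qed.

Lemma bousfield_act_constA c x : zpl p c -> bousfield_act (constA c) x = sc c x.
Proof.
move=> cZ; have [n nx] := bousfield_theta_poly x.
rewrite (bousfield_actE (F := c%:P) _ nx) ?(poly_actC RM) ?polyOverC // => i _.
by rewrite /eval_nodes hornerC.
Qed.

Lemma bousfield_act_psiA j x : zunit p j -> bousfield_act (psiA q j) x = psi j x.
Proof.
move=> jU; have [n nx] := bousfield_theta_poly x.
have /inA_locally_poly/(_ n)[F FZ jF] := psiA_inA jU.
rewrite (bousfield_actE FZ nx jF); apply/eqP; rewrite eq_sym -subr_eq0; apply/eqP.
have [_ /(_ x)[[gs [_ gsP]] [_ cP]]] := BM.
have pZ m : zpl p (pi ^+ m) by apply/zplX/zpl_nat.
apply: (@in_span_cap gs) => m.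
(* The exponent [m.+1] is positive, as axiom (c) demands; the surplus factor p is absorbed into
   [z]. *)
suff [z zRx ->] : exists2 z, inRx p sc psi x z & psi j x - poly_act F x = sc (pi ^+ m.+1) z.
  exists (sc pi z); last by rewrite -(scM RM) ?zpl_nat // -exprSr.
  have [|cs [scs [csZ ->]]] := gsP (sc pi z); last exact: in_span_sum.
  by apply: (inRx_sc RM) => //; apply: zpl_nat.
have [k kP] := cP m.+1 isT; have [N appN] := psiA_approx n.
(* One [s] close enough for both purposes: (c) compares [psi j] with [psi (qr ^+ s)] on [x], and
   [psiA_approx] compares Psi^j in A with X^s at the nodes. *)
have [s js] := zunit_approx (maxn k (N + m.+1)) jU.
have [G GZ jG] := appN _ _ _ jU (zpl_le (leq_maxr _ _) js).
have := kP _ _ jU (zunitX s qr_zunit) _ x (inRx_refl RM x).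
rewrite !natrX => /(_ (zpl_le (leq_maxl _ _) js))[z [zRx jz]].
have XGZ : 'X^s + pi ^+ m.+1 *: G \is a Zp_poly.
  by rewrite rpredD ?polyOverXn // polyOverZ //; apply: pZ.
have -> : poly_act F x = poly_act ('X^s + pi ^+ m.+1 *: G) x.
  by apply: (poly_act_agree nx) => // i ltin; rewrite -jF // jG.
exists (z - poly_act G x); first by apply: (inRxB RM) => //; apply: inRx_poly_act.
rewrite (scDr RM) // (scN RM) // -jz (poly_actD RM) ?polyOverXn ?polyOverZ //; last exact: pZ.
by rewrite (poly_actXn RM) (poly_actZ RM) // opprD addrA.
Qed.

End BousfieldModules.
End PLocal.

Theorem theorem4p6 (p : nat) (q : int) :
  prime p -> odd p -> primitive_mod q (p ^ 2) ->
  (* discrete A-modules are Bousfield modules via R \subset A *)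
  (forall (M : zmodType) (act : (nat -> rat) -> M -> M),
     isAmodule p q act -> discreteA p q act ->
     bousfield p (fun c => act (constA c)) (fun j => act (psiA q j))) /\
  (* Bousfield modules carry a unique discrete A-module structure extending R *)
  (forall (M : zmodType) (sc psi : rat -> M -> M),
     bousfield p sc psi ->
     (exists act : (nat -> rat) -> M -> M,
        isAmodule p q act /\ discreteA p q act /\
        (forall c x, zpl p c -> act (constA c) x = sc c x) /\
        (forall j x, zunit p j -> act (psiA q j) x = psi j x)) /\
     (forall act1 act2 : (nat -> rat) -> M -> M,
        isAmodule p q act1 -> discreteA p q act1 ->
        (forall c x, zpl p c -> act1 (constA c) x = sc c x) ->
        (forall j x, zunit p j -> act1 (psiA q j) x = psi j x) ->
        isAmodule p q act2 -> discreteA p q act2 ->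
        (forall c x, zpl p c -> act2 (constA c) x = sc c x) ->
        (forall j x, zunit p j -> act2 (psiA q j) x = psi j x) ->
        forall f x, inA p q f -> act1 f x = act2 f x)) /\
  (* morphisms: R-linear maps between discrete A-modules are A-linear *)
  (forall (M N : zmodType) (actM : (nat -> rat) -> M -> M)
          (actN : (nat -> rat) -> N -> N) (h : M -> N),
     isAmodule p q actM -> discreteA p q actM ->
     isAmodule p q actN -> discreteA p q actN ->
     (forall x y, h (x + y) = h x + h y) ->
     (forall c x, zpl p c -> h (actM (constA c) x) = actN (constA c) (h x)) ->
     (forall j x, zunit p j -> h (actM (psiA q j) x) = actN (psiA q j) (h x)) ->
     forall f x, inA p q f -> h (actM f x) = actN f (h x)).
Proof.
move=> p_pr p_odd q_prim; split; [|split].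
- by move=> M act AM discM; apply: discrete_bousfield.
- move=> M sc psi BM; have [RM _] := BM; split.
    exists (bousfield_act p q sc psi); split; first exact: bousfield_act_isAmodule.
    split; first exact: bousfield_act_discrete.
    by split=> [c x cZ|j x jU]; [apply: bousfield_act_constA|apply: bousfield_act_psiA].
  move=> act1 act2 AM1 disc1 sc1 psi1 AM2 disc2 sc2 psi2 f x.
  exact: discrete_act_unique AM1 disc1 sc1 psi1 AM2 disc2 sc2 psi2 f x.
- move=> M N actM actN h AM discM AN discN hD hsc hpsi f x.
  exact: discrete_morphism AM discM AN discN hD hsc hpsi f x.
Qed.
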